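(* The Calkin algebra $Q=B(H)/\mathcal K(H)$ is not countably homogeneous, and this is witnessed by a quantifier-free type. That is, $Q$ is not countably homogeneous, and moreover there exist sequences $\bar a=(a_n:n\in\mathbb N)$ and $\bar b=(b_n:n\in\mathbb N)$ in $Q$ which have the same type in $Q$, an integer $k\ge 1$, and a set $\mathbf t(\bar x,y_1,\dots,y_k)$ of quantifier-free conditions in the variables $\bar x=(x_n:n\in\mathbb N)$ and $y_1,\dots,y_k$, such that there are $c_1,\dots,c_k\in Q$ for which $(\bar a,c_1,\dots,c_k)$ satisfies every condition in $\mathbf t$ in $Q$, but there are no $d_1,\dots,d_k\in Q$ for which $(\bar b,d_1,\dots,d_k)$ satisfies every condition in $\mathbf t$ in $Q$.
   Context: $H$ is a separable infinite-dimensional complex Hilbert space, $\mathcal K(H)$ is the ideal of compact operators, and $Q=B(H)/\mathcal K(H)$ is the Calkin algebra. Formulas of the logic of metric structures for (unital) C*-algebras: atomic formulas are expressions $\|t(\bar x)\|$, where $t$ is a noncommutative complex *-polynomial (constant terms allowed) in variables $\bar x=(x_1,\dots,x_n)$. The set of formulas is the smallest set containing all atomic formulas such that (i) if $f\colon[0,\infty)^n\to[0,\infty)$ is continuous and $\phi_1,\dots,\phi_n$ are formulas, then $f(\phi_1,\dots,\phi_n)$ is a formula; (ii) if $\phi$ is a formula, $m\ge 1$ and $x$ is a variable, then $\sup_{\|x\|\le m}\phi$ and $\inf_{\|x\|\le m}\phi$ are formulas. A formula is quantifier-free if it is obtained from atomic formulas using (i) only. For a C*-algebra $C$ and $a_1,\dots,a_n\in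 C$, the interpretation $\phi(a_1,\dots,a_n)^C\in[0,\infty)$ is defined by the obvious recursion (quantifiers range over the indicated balls of $C$). A condition is an expression $\phi\le r$ with $\phi$ a formula and $r\ge 0$; it is quantifier-free if $\phi$ is. A type is a set of conditions; each free variable $x$ is associated with a domain $\|x\|\le m$ for some fixed $m$. The type of a sequence (or tuple) $\bar a$ in $C$ is the set of all conditions $\phi(x_1,\dots,x_m)\le r$ such that $\phi(a_1,\dots,a_m)^C\le r$. $C$ is countably homogeneous if for any two sequences $\bar a=(a_n:n\in\mathbb N)$ and $\bar b=(b_n:n\in\mathbb N)$ in $C$ with the same type and every $c\in C$ there exists $d\in C$ such that $(\bar a,c)$ and $(\bar b,d)$ have the same type in $C$. *)

(* Defs.v *)
From HB Require Import structures.
From mathcomp Require Import all_boot all_order all_algebra.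
From mathcomp Require Import complex.
From mathcomp Require Import generic_quotient ring_quotient.
From mathcomp Require Import all_classical all_reals all_analysis.

Set Implicit Arguments.
Unset Strict Implicit.
Unset Printing Implicit Defensive.

Import Order.TTheory GRing.Theory Num.Theory.
Import numFieldNormedType.Exports.
Local Open Scope classical_set_scope.
Local Open Scope ring_scope.

Section BoundedOperators.
Variables (R : realType) (H : normedModType R[i]).

Definition bounded_linear : {pred H -> H} :=
  fun T => `[< linear T /\ exists M : R[i], forall x, `|T x| <= M * `|x| >].

Lemma bounded_linearP (T : H -> H) :
  reflect (linear T /\ exists2 M : R[i], 0 <= M & forall x, `|T x| <= M * `|x|)
          (T \in bounded_linear).
Proof.
apply: (iffP (asboolP _)) => -[linT [M]]; last by move=> _ HM; split => //; exists M.
move=> HM; split=> //; exists `|M| => // x.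
have [->|x0] := eqVneq x 0.
  by rewrite normr0 mulr0 (le_trans (HM 0)) // normr0 mulr0.
rewrite (le_trans (HM x)) // ler_pM2r ?normr_gt0 //.
apply: real_ler_norm; suff -> : M = (M * `|x|) / `|x|.
  apply: realM; last by rewrite realV normr_real.
  exact: ger0_real (le_trans (normr_ge0 _) (HM x)).
by rewrite mulfK // normr_eq0.
Qed.

Lemma bounded_linear_submod : GRing.submod_closed bounded_linear.
Proof.
split.
  have E x : (0 : H -> H) x = 0 by [].
  apply/bounded_linearP; split=> [a x y|]; first by rewrite !E scaler0 addr0.
  by exists 0 => // x; rewrite E normr0 mul0r.
move=> a S T /bounded_linearP[linS [M M0 HM]] /bounded_linearP[linT [N N0 HN]].
apply/bounded_linearP; split=> [b x y|].
  by rewrite !fctE linS linT !scalerDr !scalerA mulrC addrACA.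
exists (`|a| * M + N) => [|x]; first by rewrite addr_ge0 // mulr_ge0.
rewrite fctE (le_trans (ler_normD _ _)) // mulrDl lerD //.
by rewrite normrZ -mulrA ler_wpM2l.
Qed.

HB.instance Definition _ :=
  GRing.isSubmodClosed.Build _ _ bounded_linear bounded_linear_submod.

Record bop := Bop { bop_fun :> H -> H; _ : bop_fun \in bounded_linear }.
HB.instance Definition _ := [isSub for bop_fun].
HB.instance Definition _ := [Choice of bop by <:].
HB.instance Definition _ := [SubChoice_isSubLmodule of bop by <:].

Implicit Types S T : bop.

Lemma bop_linear T : linear T.
Proof. by case/bounded_linearP: (valP T). Qed.

Lemma bop_bounded T :
  exists2 M : R[i], 0 <= M & forall x, `|T x| <= M * `|x|.
Proof. by case/bounded_linearP: (valP T). Qed.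

Lemma bopB T x y : T (x - y) = T x - T y.
Proof. by rewrite -scaleN1r addrC bop_linear scaleN1r addrC. Qed.

Lemma bop0 T : T 0 = 0.
Proof. by rewrite -[in LHS](subrr 0) bopB subrr. Qed.

Lemma bopZ T a x : T (a *: x) = a *: T x.
Proof. by rewrite -[a *: x]addr0 bop_linear bop0 addr0. Qed.

Lemma bop_continuous T : continuous T.
Proof.
have [M M0 HM] := bop_bounded T => x; apply/cvgrPdist_lt => e e0.
near=> y; rewrite -bopB (le_lt_trans (HM _)) //.
apply: (@le_lt_trans _ _ ((M + 1) * `|x - y|)).
  by rewrite ler_wpM2r // lerDl.
rewrite mulrC -ltr_pdivlMr ?ltr_wpDl //.
by near: y; apply: cvgr_dist_lt => //; rewrite divr_gt0 ?ltr_wpDl.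
Unshelve. all: by end_near. Qed.

Lemma bop1_subproof : (@idfun H) \in @bounded_linear.
Proof. by apply/bounded_linearP; split=> //; exists 1 => // x; rewrite mul1r. Qed.
Definition bop1 : bop := Sub idfun bop1_subproof.

Lemma bopM_subproof S T : S \o T \in @bounded_linear.
Proof.
apply/bounded_linearP; split=> [a x y|]; first by rewrite /= !bop_linear.
have [M M0 HM] := bop_bounded S; have [N N0 HN] := bop_bounded T.
exists (M * N) => [|x]; first exact: mulr_ge0.
by rewrite (le_trans (HM _)) // -mulrA ler_wpM2l.
Qed.
Definition bopM S T : bop := Sub (S \o T) (bopM_subproof S T).

Lemma bopMA : associative bopM. Proof. by move=> ? ? ?; exact: val_inj. Qed.
Lemma bop1M : left_id bop1 bopM. Proof. by move=> ?; exact: val_inj. Qed.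
Lemma bopM1 : right_id bop1 bopM. Proof. by move=> ?; exact: val_inj. Qed.
Lemma bopMDl : left_distributive bopM +%R.
Proof. by move=> ? ? ?; exact: val_inj. Qed.
Lemma bopMDr : right_distributive bopM +%R.
Proof.
move=> S T U; apply: val_inj; apply/funext => x /=.
by rewrite !fctE /= -[T x]scale1r bop_linear !scale1r.
Qed.
HB.instance Definition _ :=
  GRing.Zmodule_isPzRing.Build bop bopMA bop1M bopM1 bopMDl bopMDr.

Definition opnorm T : R :=
  sup [set complex.Re `|T x| | x in [set x | `|x| <= 1]].

Definition compact_op : {pred bop} :=
  fun T => `[< precompact (T @` [set x | `|x| <= 1]) >].

Let hausH : hausdorff_space H. Proof. exact: norm_hausdorff. Qed.

Lemma compact_opP T :
  (exists2 A, compact A & forall x, `|x| <= 1 -> A (T x)) ->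
  T \in compact_op.
Proof.
move=> [A cA TA]; apply/asboolP; exists A; first by move=> _ [x /TA ? <-].
by split=> //; exact: compact_closed.
Qed.

Lemma compact_opE T : T \in compact_op ->
  exists2 A, compact A & forall x, `|x| <= 1 -> A (T x).
Proof. by move=> /asboolP[A TA [cA _]]; exists A => // x x1; apply: TA; exists x. Qed.

Lemma compact_opMl S T : T \in compact_op -> S * T \in compact_op.
Proof.
move=> /compact_opE[A cA TA]; apply: compact_opP; exists (S @` A).
  apply: continuous_compact => //; apply: continuous_subspaceT.
  exact: bop_continuous.
by move=> x /TA ?; exists (T x).
Qed.

Lemma compact_opZ a T : T \in compact_op -> a *: T \in compact_op.
Proof.
suff -> : a *: T = (a *: (1 : bop)) * T by exact: compact_opMl.
exact: val_inj.
Qed.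

Lemma compact_opMr S T : S \in compact_op -> S * T \in compact_op.
Proof.
have [M M0 HM] := bop_bounded T => cS.
have M1 : 0 < M + 1 by rewrite ltr_wpDl.
have /compact_opE[A cA SA] := compact_opZ (M + 1) cS.
apply: compact_opP; exists A => // x x1.
suff -> : (S * T) x = ((M + 1) *: S) ((M + 1)^-1 *: T x).
  apply: SA; rewrite normrZ gtr0_norm ?invr_gt0 // mulrC ler_pdivrMr // mul1r.
  by rewrite (le_trans (HM x)) // (le_trans (ler_wpM2l M0 x1)) // mulr1 lerDl.
by rewrite /= fctE bopZ scalerA mulfV ?scale1r // gt_eqF.
Qed.

Lemma compact_op_zmod : GRing.zmod_closed compact_op.
Proof.
split.
  by apply: compact_opP; exists [set 0]; first exact: compact_set1.
move=> S T /compact_opE[A cA SA] /compact_opE[B cB TB]; apply: compact_opP.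
exists ((fun p : H * H => p.1 - p.2) @` (A `*` B)); last first.
  by move=> x x1; exists (S x, T x) => //; split; [exact: SA|exact: TB].
apply: continuous_compact; last exact: compact_setX.
apply: continuous_subspaceT => p.
by apply: cvgB; [exact: cvg_fst|exact: cvg_snd].
Qed.

HB.instance Definition _ :=
  GRing.isZmodClosed.Build bop compact_op compact_op_zmod.

End BoundedOperators.

Arguments compact_op {R H}.

(* Unital C*-algebras as structures of continuous logic: only the operations enter
   the interpretation of formulas, so the C*-algebra axioms are not part of this
   signature. *)
HB.mixin Record hasScaleStarNorm (R : realType) (C : Type) := {
  cscale : R[i] -> C -> C;
  star : C -> C;
  cnorm : C -> R
}.

#[short(type="cstarSigType")]
HB.structure Definition CstarSig (R : realType) :=
  {C of GRing.PzRing C & hasScaleStarNorm R C}.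

Arguments cscale {R C} : rename.
Arguments star {R C} : rename.
Arguments cnorm {R C} : rename.

(* The involution of the quotient depends on the inner product, whence the phantom
   argument [dot] of the type. *)
Definition calkin (R : realType) (H : completeNormedModType R[i])
  (dot : {dot H for Num.conj}) : Type := Quotient.quot (@compact_op R H).

Section Calkin.
Variables (R : realType) (H : completeNormedModType R[i]).
Variable dot : {dot H for Num.conj}.
Local Open Scope quotient_scope.
Local Notation calkin := (calkin dot).
Implicit Types (S T : bop H) (p q r : calkin).

(* In a Hilbert space the set below is a singleton; 0 is only a formal default. *)
Definition adjoint T : bop H :=
  xget 0 [set S : bop H | forall x y, dot (T x) y = dot x (S y)].

HB.instance Definition _ := GRing.Zmodule.on calkin.
HB.instance Definition _ := EqQuotient.on calkin.

Lemma calkin_eqP S T :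
  reflect (S = T %[mod calkin]) (S - T \in compact_op).
Proof. by rewrite (Quotient.idealrBE compact_op); exact: eqP. Qed.

Definition calkin1 : calkin := \pi_(calkin) 1.
Definition calkinM := lift_op2 calkin *%R.
Definition calkinZ (a : R[i]) := lift_op1 calkin (fun T => a *: T).

Lemma pi_calkinD S T : \pi_(calkin) (S + T) = \pi_(calkin) S + \pi_(calkin) T.
Proof. exact: (@Quotient.pi_add _ compact_op). Qed.

Lemma calkin_repr T : T - repr (\pi_(calkin) T) \in compact_op.
Proof. by apply/calkin_eqP; rewrite reprK. Qed.

Lemma pi_calkinM S T : \pi_(calkin) (S * T) = calkinM (\pi_(calkin) S) (\pi_(calkin) T).
Proof.
unlock calkinM; apply/calkin_eqP; move: (calkin_repr S) (calkin_repr T).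
set S' := repr _; set T' := repr _ => SS' TT'.
have -> : S * T - S' * T' = S * (T - T') + (S - S') * T'.
  by rewrite mulrBr mulrBl addrA subrK.
by rewrite rpredD; [|exact: compact_opMl|exact: compact_opMr].
Qed.

Lemma pi_calkinZ a T : \pi_(calkin) (a *: T) = calkinZ a (\pi_(calkin) T).
Proof.
by unlock calkinZ; apply/calkin_eqP; rewrite -scalerBr compact_opZ // calkin_repr.
Qed.

Lemma calkinMA : associative calkinM.
Proof. by move=> p q r; rewrite -[p]reprK -[q]reprK -[r]reprK -!pi_calkinM mulrA. Qed.
Lemma calkin1M : left_id calkin1 calkinM.
Proof. by move=> p; rewrite -[p]reprK -pi_calkinM mul1r. Qed.
Lemma calkinM1 : right_id calkin1 calkinM.
Proof. by move=> p; rewrite -[p]reprK -pi_calkinM mulr1. Qed.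
Lemma calkinMDl : left_distributive calkinM +%R.
Proof.
move=> p q r; rewrite -[p]reprK -[q]reprK -[r]reprK.
by rewrite -!(pi_calkinM, pi_calkinD) mulrDl.
Qed.
Lemma calkinMDr : right_distributive calkinM +%R.
Proof.
move=> p q r; rewrite -[p]reprK -[q]reprK -[r]reprK.
by rewrite -!(pi_calkinM, pi_calkinD) mulrDr.
Qed.
HB.instance Definition _ := GRing.Zmodule_isPzRing.Build calkin
  calkinMA calkin1M calkinM1 calkinMDl calkinMDr.

Lemma calkinZA a b p : calkinZ a (calkinZ b p) = calkinZ (a * b) p.
Proof. by rewrite -[p]reprK -!pi_calkinZ scalerA. Qed.
Lemma calkin1Z : left_id 1 calkinZ.
Proof. by move=> p; rewrite -[p]reprK -pi_calkinZ scale1r. Qed.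
Lemma calkinZDr : right_distributive calkinZ +%R.
Proof.
by move=> a p q; rewrite -[p]reprK -[q]reprK -!(pi_calkinZ, pi_calkinD) scalerDr.
Qed.
Lemma calkinZDl p : {morph calkinZ^~ p : a b / a + b}.
Proof. by move=> a b; rewrite -[p]reprK -!(pi_calkinZ, pi_calkinD) scalerDl. Qed.
HB.instance Definition _ := GRing.Zmodule_isLmodule.Build _ calkin
  calkinZA calkin1Z calkinZDr calkinZDl.

(* The adjoint maps [compact_op] to itself, so the class does not depend on the
   representative. *)
Definition calkin_star (p : calkin) : calkin := \pi_(calkin) (adjoint (repr p)).

Definition calkin_norm (p : calkin) : R :=
  inf [set opnorm T | T in [set T | \pi_(calkin) T = p]].

HB.instance Definition _ := hasScaleStarNorm.Build R calkin
  ( *:%R : R[i] -> calkin -> calkin) calkin_star calkin_norm.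

End Calkin.

Section Syntax.
Variables (R : realType) (V : eqType).

(* A finite sum of monomials [a x_1^{e_1} ... x_l^{e_l}], the flag of a letter
   telling whether it is starred; the empty word is the unit. *)
Definition starpoly := seq (R[i] * seq (V * bool)).

Definition nneg_orthant (n : nat) : set 'rV[R]_n := [set u | forall i, 0 <= u ord0 i].

Record connective n := Connective {
  conn_fun :> 'rV[R]_n -> R;
  conn_continuous : {within @nneg_orthant n, continuous conn_fun};
  conn_ge0 : forall u, nneg_orthant u -> 0 <= conn_fun u
}.

Inductive formula :=
| Atom of starpoly
| Conn n of connective n & ('I_n -> formula)
| Sup (m : nat) of (0 < m)%N & V & formula
| Inf (m : nat) of (0 < m)%N & V & formula.

Fixpoint quantifier_free (phi : formula) : Prop :=
  match phi with
  | Atom _ => True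
  | Conn _ _ psi => forall i, quantifier_free (psi i)
  | Sup _ _ _ _ | Inf _ _ _ _ => False
  end.

(* [Cond phi r] is the condition [phi <= r]. *)
Record condition := Cond { cond_formula : formula; cond_bound : {nonneg R} }.

Definition domain_condition (x : V) (m : nat) : condition :=
  Cond (Atom [:: (1, [:: (x, false)])]) m%:R%:nng.

(* The domain [||x|| <= m] of a variable is recorded as one of the conditions of the
   type, so that realizations automatically lie in the domains. *)
Definition has_domains (t : set condition) :=
  forall x, exists2 m, (0 < m)%N & t (domain_condition x m).

End Syntax.

Section Semantics.
Variables (R : realType) (C : cstarSigType R) (V : eqType).
Implicit Types (v : V -> C) (phi : formula R V) (t : set (condition R V)).

Definition starpoly_eval v (p : starpoly R V) : C :=
  \sum_(m <- p) cscale m.1 (\prod_(l <- m.2) (if l.2 then star (v l.1) else v l.1)).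

Definition update v (x : V) (c : C) : V -> C := fun y => if y == x then c else v y.

(* The interpretation of a formula is bounded on bounded balls, so that the default
   value of [sup] on unbounded sets is never used in a C*-algebra. *)
Fixpoint interp v phi : R :=
  match phi with
  | Atom p => cnorm (starpoly_eval v p)
  | Conn _ f psi => f (\row_i interp v (psi i))
  | Sup m _ x psi =>
      sup [set interp (update v x c) psi | c in [set c | cnorm c <= m%:R]]
  | Inf m _ x psi =>
      inf [set interp (update v x c) psi | c in [set c | cnorm c <= m%:R]]
  end.

Definition satisfies v (k : condition R V) :=
  interp v (cond_formula k) <= (cond_bound k)%:num.

Definition realizes v t := forall k, t k -> satisfies v k.

Definition type_of v : set (condition R V) := [set k | satisfies v k].

End Semantics.

Section Homogeneity.
Variables (R : realType) (C : cstarSigType R).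

Definition extend (a : nat -> C) k (c : 'I_k -> C) : (nat + 'I_k)%type -> C :=
  fun x => match x with inl n => a n | inr i => c i end.

Definition countably_homogeneous :=
  forall a b : nat -> C, type_of a = type_of b ->
  forall c : C, exists d : C,
    type_of (extend a (fun _ : 'I_1 => c)) = type_of (extend b (fun _ : 'I_1 => d)).

End Homogeneity.

Arguments countably_homogeneous {R} C.

Definition separable (T : topologicalType) :=
  exists2 D : set T, countable D & dense D.

Definition infinite_dimensional (K : fieldType) (E : lmodType K) :=
  forall s : seq E, exists x : E,
    forall a : 'I_(size s) -> K, x <> \sum_i a i *: s`_i.

(* Main.v *)
Require Import Defs.
From mathcomp Require Import all_boot all_order all_algebra.
From mathcomp Require Import complex.
From mathcomp Require Import ring lra zify.
From mathcomp Require Import all_classical all_reals all_analysis.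
Import Order.TTheory GRing.Theory Num.Theory.
Import numFieldNormedType.Exports.
Local Open Scope classical_set_scope.
Local Open Scope ring_scope.

Set Implicit Arguments.
Unset Strict Implicit.
Unset Printing Implicit Defensive.

(** The obstruction is a Fredholm index with values in the 2-adic integers that
    is not an integer.

    Fix an orthonormal basis e_0, e_1, ... ; for injective f let [push f] be the
    isometry sending e_n to e_(f n), [pull f] its adjoint, and let w be the class
    of the unilateral shift in the Calkin algebra Q. For N = 4^n the isometries
    S_i sending e_m to e_(N m + i), i < N, have orthogonal ranges summing to 1, so
    the elements S_0 S_i^* are the first row of a system of N x N matrix units, and
    what commutes with this row are the amplifications sum_(i < N) S_i T S_i^*. The
    shift by N is the amplification of the shift by 1.

    The sequence a contains these rows (level n) for all n, twice: once
    compressed to the span of the even basis vectors, once to the span of the odd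
    ones. In the sequence b the even copy is the same, but level n of the odd copy
    is conjugated by w^(k_n), where k_n = 1 + 4 + ... + 4^(n-1) = (4^n - 1) / 3.

    The types agree ([same_type]): w^(4^n) commutes with level n, and k_m = k_n
    mod 4^n for n <= m, so a single unitary of Q, acting as w^(k_m) on the odd
    corner, conjugates all levels up to m of a into those of b. A formula has
    finitely many free variables, and conjugation is an automorphism.

    A quantifier-free type tells a and b apart: an element carrying the even corner
    onto the odd one and intertwining the two copies exists over a. Over b it would
    give an invertible D such that, for every n, w^(-k_n) D commutes with level n
    ([no_intertwiner]). The latter is then an amplification, so its index is
    divisible by 4^n, and the index j of D, counted so that w has index 1,
    satisfies j = k_n mod 4^n, hence 3 j = -1 mod 4^n, for all n, which no integer
    does.

    The index is not introduced as a number. It is enough to know which classes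
    lift to invertible operators: every invertible class does after multiplication
    by powers of w and w^* ([fredholm_liftable]), no positive power of w does
    ([shift_not_liftable]), and lifting is preserved by amplification, which takes
    w to w^N ([commutant_index]). *)

(** * The norm as a real number, and inner products *)

Lemma ltr0C (R : realType) (r : R) : (0 < r%:C%C) = (0 < r).
Proof. exact: ltcR. Qed.

Section Norm.
Variables (R : realType) (H : completeNormedModType R[i]).
Implicit Types x y z : H.

(** The norm of H takes its values in R[i], where the order is partial; its real
    part makes the arithmetic of realType available. *)
Definition rnorm x : R := complex.Re `|x|.

Lemma rnormE x : `|x| = (rnorm x)%:C%C.
Proof. by rewrite /rnorm RRe_real // normr_real. Qed.

Lemma rnorm_ge0 x : 0 <= rnorm x.
Proof. by rewrite -lecR -rnormE normr_ge0. Qed.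

Lemma rnorm0 : rnorm (0 : H) = 0.
Proof. by rewrite /rnorm normr0. Qed.

Lemma rnorm_eq0 x : rnorm x = 0 -> x = 0.
Proof. by move=> x0; apply/normr0_eq0; rewrite rnormE x0. Qed.

Lemma rnormN x : rnorm (- x) = rnorm x.
Proof. by rewrite /rnorm normrN. Qed.

Lemma rnormB x y : rnorm (x - y) = rnorm (y - x).
Proof. by rewrite -rnormN opprB. Qed.

Lemma rnorm_triangle x y : rnorm (x + y) <= rnorm x + rnorm y.
Proof. by rewrite -lecR rmorphD /= -!rnormE ler_normD. Qed.

Lemma rnormZ (c : R[i]) x : rnorm (c *: x) = complex.Re `|c| * rnorm x.
Proof.
by apply: (@complexI R); rewrite -rnormE normrZ rmorphM /= rnormE RRe_real.
Qed.

Lemma rnorm_small x y :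
  (forall eps : R, 0 < eps -> rnorm (x - y) <= eps) -> x = y.
Proof.
move=> small; apply/subr0_eq/rnorm_eq0/eqP; rewrite eq_le rnorm_ge0 andbT.
by apply/ler_addgt0Pr => e e0; rewrite add0r small.
Qed.

Lemma complete_seq (u : nat -> H) :
  (forall eps : R, 0 < eps -> exists N, forall m n,
     (N <= m)%N -> (N <= n)%N -> rnorm (u m - u n) < eps) ->
  exists l, forall eps : R, 0 < eps -> exists N, forall n,
     (N <= n)%N -> rnorm (u n - l) < eps.
Proof.
move=> cu; have /cauchy_cvg ul : cauchy (u @ \oo).
  apply/cauchy_ballP => e e0; near_simpl.
  have eE : e = (complex.Re e)%:C%C by rewrite RRe_real // gtr0_real.
  have := e0; rewrite eE ltr0C => /cu[N HN].
  near=> m n => /=; rewrite -ball_normE /= rnormE ltcR HN //.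
    by near: m; exact: nbhs_infty_ge.
  by near: n; exact: nbhs_infty_ge.
exists (lim (u @ \oo)) => e e0; move/cvgrPdist_lt: ul => /(_ e%:C%C).
rewrite ltr0C => /(_ e0)[N _ HN]; exists N => n Nn.
by have := HN n Nn; rewrite rnormE ltcR rnormB.
Unshelve. all: by end_near. Qed.

End Norm.

Lemma complex_small (R : realType) (z : R[i]) :
  (forall eps : R, 0 < eps -> `|z| <= eps%:C%C) -> z = 0.
Proof.
have zE : `|z| = (complex.Re `|z|)%:C%C by rewrite RRe_real // normr_real.
move=> small; apply/normr0_eq0/eqP; rewrite eq_le normr_ge0 andbT zE lecR.
by apply/ler_addgt0Pr => eps e0; rewrite add0r -lecR -zE small.
Qed.

Section InnerProduct.
Variables (R : realType) (H : completeNormedModType R[i]).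
Variable dot : {dot H for Num.conj}.
Hypothesis dot_norm : forall x : H, `|x| ^+ 2 = dot x x.
Implicit Types x y z : H.

Lemma dotC x y : dot x y = (dot y x)^*.
Proof. by rewrite hermC expr0 mul1r. Qed.

Lemma dotDl x y z : dot (x + y) z = dot x z + dot y z.
Proof. exact: linearDl. Qed.
Lemma dotBl x y z : dot (x - y) z = dot x z - dot y z.
Proof. exact: linearBl. Qed.
Lemma dotZl c x y : dot (c *: x) y = c * dot x y.
Proof. exact: linearZl_LR. Qed.
Lemma dotDr x y z : dot x (y + z) = dot x y + dot x z.
Proof. exact: linearDr. Qed.
Lemma dotBr x y z : dot x (y - z) = dot x y - dot x z.
Proof. exact: linearBr. Qed.
Lemma dotZr c x y : dot x (c *: y) = c^* * dot x y.
Proof. exact: linearZr_LR. Qed.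
Lemma dot0l x : dot 0 x = 0.
Proof. exact: linear0l. Qed.
Lemma dot0r x : dot x 0 = 0.
Proof. exact: linear0r. Qed.
Lemma dot_suml I (r : seq I) (P : pred I) (F : I -> H) y :
  dot (\sum_(i <- r | P i) F i) y = \sum_(i <- r | P i) dot (F i) y.
Proof. exact: linear_sumlz. Qed.

Lemma pythagoras x y : dot x y = 0 ->
  dot (x + y) (x + y) = dot x x + dot y y.
Proof.
by move=> xy; rewrite dotDl !dotDr xy (dotC y x) xy conjC0 addr0 add0r.
Qed.

Lemma dot_ext x y : (forall z, dot x z = dot y z) -> x = y.
Proof.
move=> xy; apply/subr0_eq/normr0_eq0/eqP.
by rewrite -sqrf_eq0 dot_norm dotBl xy subrr.
Qed.

Lemma sqr_rnorm x : (rnorm x ^+ 2)%:C%C = dot x x.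
Proof. by rewrite rmorphXn /= -rnormE dot_norm. Qed.

Lemma cauchy_schwarz x y : `|dot x y| <= `|x| * `|y|.
Proof.
have [->|y0] := eqVneq y 0; first by rewrite dot0r !normr0 mulr0.
have dy0 : 0 < dot y y by rewrite -dot_norm exprn_gt0 // normr_gt0.
rewrite -(@ler_pXn2r _ 2) ?nnegrE ?mulr_ge0 // exprMn !dot_norm.
rewrite -ler_pdivrMr // -subr_ge0.
set a := dot x y / dot y y.
suff -> : dot x x - `|dot x y| ^+ 2 / dot y y = `|x - a *: y| ^+ 2.
  exact: exprn_ge0.
have dyr : (dot y y)^* = dot y y by rewrite -dotC.
rewrite dot_norm dotBl !dotBr !dotZl !dotZr (dotC y x) normCK rmorphM /=.
rewrite fmorphV /= dyr /a.
by field; rewrite gt_eqF.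
Qed.

Lemma cauchy_schwarz_real x y : `|dot x y| <= (rnorm x * rnorm y)%:C%C.
Proof. by rewrite rmorphM /= -!rnormE cauchy_schwarz. Qed.

(** The bound on the adjoint comes from |T^* x|^2 = <T T^* x, x>; this is the step
    from such an identity to a bound on the vector. *)
Lemma rnorm_le_self_dot x y z (B : R) : dot x x = dot y z ->
  rnorm y * rnorm z <= B * rnorm x -> 0 <= B -> rnorm x <= B.
Proof.
move=> xyz yzB B0; have [->//|x0] := eqVneq (rnorm x) 0.
have xp : 0 < rnorm x by rewrite lt_def x0 rnorm_ge0.
rewrite -(ler_pM2r xp) -expr2 (le_trans _ yzB) // -lecR.
have <- : `|dot y z| = (rnorm x ^+ 2)%:C%C.
  by rewrite -xyz sqr_rnorm ger0_norm // -dot_norm exprn_ge0.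
exact: cauchy_schwarz_real.
Qed.

End InnerProduct.

(** * Orthonormal sequences and square-summable coefficients *)
Section Orthonormal.
Variables (R : realType) (H : completeNormedModType R[i]).
Variable dot : {dot H for Num.conj}.
Hypothesis dot_norm : forall x : H, `|x| ^+ 2 = dot x x.
Implicit Types (x y z : H) (e : nat -> H) (c : nat -> R[i]).

Definition orthonormal_upto e n :=
  forall i j, (i < n)%N -> (j < n)%N -> dot (e i) (e j) = (i == j)%:R.

Definition orthonormal_seq e := forall i j, dot (e i) (e j) = (i == j)%:R.

Definition fourier e m x := \sum_(i < m) dot x (e i) *: e i.

Definition sqnorm (a : R[i]) : R := complex.Re (`|a| ^+ 2).

Lemma sqnormE (a : R[i]) : (sqnorm a)%:C%C = `|a| ^+ 2.
Proof. by rewrite /sqnorm RRe_real // rpredX // normr_real. Qed.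

Lemma sqnorm_ge0 (a : R[i]) : 0 <= sqnorm a.
Proof. by rewrite -lecR sqnormE exprn_ge0. Qed.

Lemma dot_comb e m c j : orthonormal_upto e m -> (j < m)%N ->
  dot (\sum_(i < m) c i *: e i) (e j) = c j.
Proof.
move=> oe jm; rewrite dot_suml (bigD1 (Ordinal jm)) //= dotZl oe // eqxx mulr1.
rewrite big1 ?addr0 // => i ij; rewrite dotZl oe //.
by rewrite (_ : (_ == _ :> nat) = false) ?mulr0 //; apply/negbTE.
Qed.

Lemma dot_comb_out e m c j : orthonormal_seq e -> (m <= j)%N ->
  dot (\sum_(i < m) c i *: e i) (e j) = 0.
Proof.
move=> oe mj; rewrite dot_suml big1 // => i _; rewrite dotZl oe.
by rewrite ltn_eqF ?mulr0 // (leq_trans (ltn_ord i)).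
Qed.

Lemma norm_comb e c m n : orthonormal_seq e ->
  rnorm (\sum_(m <= i < n) c i *: e i) ^+ 2 = \sum_(m <= i < n) sqnorm (c i).
Proof.
move=> oe; elim: n => [|n IH]; first by rewrite !big_geq // rnorm0 expr0n.
have [mn|nm] := leqP m n; last by rewrite !big_geq // rnorm0 expr0n.
rewrite !big_nat_recr //= -IH; apply: (@complexI R).
rewrite rmorphD /= !(sqr_rnorm dot_norm) // sqnormE pythagoras; last first.
  rewrite dot_suml big_nat big1 // => i /andP[_ ni].
  by rewrite dotZl dotZr oe ltn_eqF // !mulr0.
by congr (_ + _); rewrite dotZl dotZr oe eqxx mulr1 normCK.
Qed.

Lemma dot_fourier e m x j : orthonormal_upto e m -> (j < m)%N ->
  dot (fourier e m x) (e j) = dot x (e j).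
Proof. by move=> oe jm; rewrite (dot_comb (fun i => dot x (e i)) oe). Qed.

Lemma dot_fourier_out e m x j : orthonormal_seq e -> (m <= j)%N ->
  dot (fourier e m x) (e j) = 0.
Proof.
by move=> oe mj; rewrite (dot_comb_out (fun i => dot x (e i)) oe mj).
Qed.

Lemma fourier_orth e m x : orthonormal_upto e m ->
  dot (x - fourier e m x) (fourier e m x) = 0.
Proof.
move=> oe; rewrite dotC {1}/fourier dot_suml big1 ?conjC0 // => i _.
by rewrite dotZl [dot (e i) _]dotC dotBl dot_fourier // subrr conjC0 mulr0.
Qed.

Lemma fourier_bound e m x : orthonormal_upto e m ->
  rnorm (x - fourier e m x) <= rnorm x.
Proof.
move=> oe; rewrite -(@ler_pXn2r _ 2) ?nnegrE ?rnorm_ge0 // -lecR !(sqr_rnorm dot_norm) //.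
have orth := fourier_orth x oe.
rewrite -[in leRHS](subrK (fourier e m x) x) [leRHS]pythagoras // lerDl.
by rewrite -dot_norm exprn_ge0.
Qed.

Lemma fourierB e m x y : fourier e m (x - y) = fourier e m x - fourier e m y.
Proof. by rewrite -sumrB; apply: eq_bigr => i _; rewrite dotBl scalerBl. Qed.

Lemma bessel e m x : orthonormal_seq e ->
  \sum_(i < m) sqnorm (dot x (e i)) <= rnorm x ^+ 2.
Proof.
move=> oe; rewrite -(big_mkord xpredT (fun i => sqnorm (dot x (e i)))).
rewrite -(norm_comb _ 0 m oe) big_mkord -lecR !(sqr_rnorm dot_norm) //.
have oe' : orthonormal_upto e m by move=> i j _ _.
have orth := fourier_orth x oe'.
rewrite -[in leRHS](subrK (fourier e m x) x) [leRHS]pythagoras // lerDr.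
by rewrite -dot_norm exprn_ge0.
Qed.

(** Riesz-Fischer: the partial sums are Cauchy because their squared distances are
    differences of a bounded nondecreasing real sequence. All operators below are
    built from coefficient sequences through this lemma. *)
Lemma l2_synthesis e c (M : R) : orthonormal_seq e ->
  (forall m, \sum_(i < m) sqnorm (c i) <= M) ->
  exists2 z, forall n, dot z (e n) = c n & rnorm z ^+ 2 <= M.
Proof.
move=> oe cM.
pose s m := \sum_(0 <= i < m) sqnorm (c i).
pose u m := \sum_(0 <= i < m) c i *: e i.
have sM m : s m <= M by rewrite /s big_mkord.
have M0 : 0 <= M by rewrite (le_trans _ (sM 0%N)) // /s big_geq.
have sS m n : (m <= n)%N -> s n = s m + \sum_(m <= i < n) sqnorm (c i).
  by move=> mn; rewrite /s (big_cat_nat (leq0n m) mn).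
have smono m n : (m <= n)%N -> s m <= s n.
  by move=> /sS ->; rewrite lerDl sumr_ge0 // => i _; exact: sqnorm_ge0.
have us m n : (m <= n)%N -> rnorm (u n - u m) ^+ 2 = s n - s m.
  move=> mn; rewrite (sS _ _ mn) [RHS]addrAC subrr add0r.
  by rewrite /u (big_cat_nat (leq0n m) mn) /= addrAC subrr add0r norm_comb.
have scvg : cvgn s.
  by apply: nondecreasing_is_cvgn => //; exists M => _ [m _ <-].
have [|z uz] := complete_seq (u := u).
  move=> eps e0.
  have /cvgrPdist_lt/(_ (eps ^+ 2 / 2)) := scvg.
  rewrite divr_gt0 ?exprn_gt0 // => /(_ isT)[N _ HN].
  have key m n : (N <= m)%N -> (m <= n)%N -> rnorm (u n - u m) < eps.
    move=> Nm mn; rewrite -(@ltr_pXn2r _ 2) ?nnegrE ?rnorm_ge0 ?ltW // us //.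
    have := HN m Nm; have := HN n (leq_trans Nm mn) => /=.
    rewrite !ltr_norml => /andP[? ?] /andP[? ?]; lra.
  exists N => m n Nm Nn; have [mn|nm] := leqP m n; last exact/key/ltnW.
  by rewrite rnormB key.
have uM m : rnorm (u m) <= Num.sqrt M.
  rewrite -ler_sqr ?nnegrE ?rnorm_ge0 ?sqrtr_ge0 // sqr_sqrtr // norm_comb //.
  exact: sM.
exists z => [n|]; last first.
  rewrite -[leRHS](sqr_sqrtr M0) ler_sqr ?nnegrE ?rnorm_ge0 ?sqrtr_ge0 //.
  apply/ler_addgt0Pr => eps e0; have [N HN] := uz _ e0.
  rewrite -(subrK (u N) z) (le_trans (rnorm_triangle _ _)) // addrC.
  by rewrite lerD // rnormB ltW // HN.
apply/subr0_eq/complex_small => eps e0; have [N HN] := uz _ e0.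
have -> : c n = dot (u (maxn N n.+1)) (e n).
  by rewrite /u big_mkord dot_comb ?leq_max ?ltnSn ?orbT // => i j _ _.
rewrite -dotBl (le_trans (cauchy_schwarz _ _ _)) //.
have -> : `|e n| = 1.
  by apply/eqP; rewrite -(@eqrXn2 _ 2) // expr1n dot_norm oe eqxx.
by rewrite mulr1 rnormE lecR rnormB ltW // HN // leq_maxl.
Qed.

Definition onb e := orthonormal_seq e /\ forall x (eps : R), 0 < eps ->
  exists m, forall n, (m <= n)%N -> rnorm (x - fourier e n x) < eps.

Lemma onb_ext e x y : onb e -> (forall n, dot x (e n) = dot y (e n)) -> x = y.
Proof.
move=> [_ ce] xy; apply: rnorm_small => eps /(ce (x - y))[m /(_ m (leqnn m))].
rewrite /fourier big1 => [|i _]; first by rewrite subr0 => /ltW.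
by rewrite dotBl xy subrr scale0r.
Qed.

End Orthonormal.

(** * Orthonormal bases of separable spaces *)
Section GramSchmidt.
Variables (R : realType) (H : completeNormedModType R[i]).
Variable dot : {dot H for Num.conj}.
Hypothesis dot_norm : forall x : H, `|x| ^+ 2 = dot x x.
Variables (D : set H) (rank : H -> nat).
Hypothesis denseD : dense D.
Hypothesis rank_inj : {in D &, injective rank}.
Hypothesis infH : infinite_dimensional H.
Implicit Types (x y z : H) (s : seq H).

Local Notation fourier := (fourier dot).
Local Notation orthonormal_upto := (orthonormal_upto dot).

Lemma dense_approx x (eps : R) : 0 < eps -> exists2 d, D d & rnorm (x - d) < eps.
Proof.
move=> e0; have xO : (ball x eps%:C%C)^° x.
  by apply: nbhsx_ballx; rewrite ltr0C.
have [|d [/interior_subset dx Dd]] := denseD _ (@open_interior _ (ball x eps%:C%C)).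
  by exists x.
by exists d => //; move: dx; rewrite -ball_normE /= rnormE ltcR.
Qed.

(** Gram-Schmidt that skips dependent vectors: the next vector is obtained from the
    element of D of least rank outside the span reached so far, so that every
    element of D is eventually in the span. *)
Definition unspanned s : set H :=
  [set d | D d /\ d <> fourier (nth 0 s) (size s) d].

Definition least_unspanned s : set H :=
  [set d | unspanned s d /\ forall d', unspanned s d' -> (rank d <= rank d')%N].

Definition gs_pick s : H := xget 0 (least_unspanned s).

Definition gs_next s : H :=
  let v := gs_pick s - fourier (nth 0 s) (size s) (gs_pick s) in `|v|^-1 *: v.

Fixpoint gs_list n : seq H :=
  if n is m.+1 then rcons (gs_list m) (gs_next (gs_list m)) else [::].

Definition gs n : H := gs_next (gs_list n).

Definition gs_picked n : H := gs_pick (gs_list n).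

Lemma gs_listE n : gs_list n = mkseq gs n.
Proof. by elim: n => // n IH; rewrite mkseqS -IH. Qed.

Lemma fourier_gs n x : fourier (nth 0 (gs_list n)) (size (gs_list n)) x = fourier gs n x.
Proof.
rewrite gs_listE size_mkseq; apply: eq_bigr => i _.
by rewrite nth_mkseq.
Qed.

Lemma unspannedE n d : unspanned (gs_list n) d <-> D d /\ d <> fourier gs n d.
Proof. by rewrite /unspanned /= fourier_gs. Qed.

(** If D were inside the span of the first n vectors, so would be its closure H,
    against the infinite dimension. *)
Lemma unspanned_exists n : orthonormal_upto gs n ->
  exists d, unspanned (gs_list n) d.
Proof.
move=> on; apply: contrapT => /forallNP none.
have [x /(_ (fun i => dot x (gs i)))] := infH (mkseq gs n); apply.
transitivity (fourier gs n x); last first.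
  rewrite /fourier -[in LHS](size_mkseq gs n); apply: eq_bigr => i _.
  by rewrite nth_mkseq // -[X in (_ < X)%N](size_mkseq gs n).
apply: rnorm_small => eps e0; have [d Dd xd] := dense_approx x e0.
have dE : d = fourier gs n d.
  by apply: contrapT => nd; apply: (none d); apply/unspannedE.
have -> : x - fourier gs n x = (x - d) - fourier gs n (x - d).
  by rewrite fourierB -dE opprB addrA subrK.
by rewrite (le_trans (fourier_bound _ _ _)) // ltW.
Qed.

Lemma gs_pickedP n : orthonormal_upto gs n ->
  [/\ D (gs_picked n), gs_picked n <> fourier gs n (gs_picked n) &
      forall d, D d -> d <> fourier gs n d -> (rank (gs_picked n) <= rank d)%N].
Proof.
move=> /unspanned_exists [d0 ud0].
suff [] : least_unspanned (gs_list n) (gs_picked n).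
  move=> /unspannedE[? ?] least; split=> // d Dd dn.
  by apply: least; apply/unspannedE.
apply: xgetPex.
pose p k := `[< exists2 d, unspanned (gs_list n) d & rank d = k >].
have exp : exists k, p k by exists (rank d0); apply/asboolP; exists d0.
case: (ex_minnP exp) => k /asboolP[d ud <-] least.
by exists d; split=> // d' ud'; apply: least; apply/asboolP; exists d'.
Qed.

Lemma gsE n : gs n =
  `|gs_picked n - fourier gs n (gs_picked n)|^-1 *:
  (gs_picked n - fourier gs n (gs_picked n)).
Proof. by rewrite /gs /gs_next -/(gs_picked n) fourier_gs. Qed.

Lemma gs_orthonormal_upto n : orthonormal_upto gs n.
Proof.
elim: n => // n IH.
have [_ /eqP pn _] := gs_pickedP IH.
set v := gs_picked n - fourier gs n (gs_picked n).
have v0 : `|v| != 0 by rewrite normr_eq0 subr_eq0.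
have vj j : (j < n)%N -> dot (gs n) (gs j) = 0.
  by move=> jn; rewrite gsE dotZl dotBl dot_fourier // subrr mulr0.
have vv : dot (gs n) (gs n) = 1.
  rewrite gsE dotZl dotZr -/v -dot_norm conj_Creal ?rpredV ?normr_real //.
  by rewrite expr2 [_ * (_ * `|v|)]mulKf // mulVf.
move=> i j; rewrite ltnS leq_eqVlt => im; rewrite ltnS leq_eqVlt => jm.
move: im jm => /predU1P[->|im] /predU1P[->|jm].
- by rewrite eqxx vv.
- by rewrite vj // gtn_eqF.
- by rewrite dotC vj // conjC0 ltn_eqF.
- exact: IH.
Qed.

Lemma gs_orthonormal : orthonormal_seq dot gs.
Proof.
move=> i j; apply: (@gs_orthonormal_upto (maxn i j).+1);
  by rewrite ltnS ?leq_maxl ?leq_maxr.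
Qed.

Lemma fourierS e n x : fourier e n.+1 x = fourier e n x + dot x (e n) *: e n.
Proof. by rewrite /fourier big_ord_recr. Qed.

Lemma fourier_fixS n x : x = fourier gs n x -> x = fourier gs n.+1 x.
Proof.
move=> xE; rewrite fourierS -xE.
have -> : dot x (gs n) = 0 by rewrite xE dot_fourier_out //; exact: gs_orthonormal.
by rewrite scale0r addr0.
Qed.

Lemma fourier_gs_picked n : gs_picked n = fourier gs n.+1 (gs_picked n).
Proof.
have [_ /eqP pn _] := gs_pickedP (@gs_orthonormal_upto n).
set v := gs_picked n - fourier gs n (gs_picked n).
have v0 : `|v| != 0 by rewrite normr_eq0 subr_eq0.
have dn : dot (gs_picked n) (gs n) = `|v|.
  have -> : gs_picked n = v + fourier gs n (gs_picked n) by rewrite subrK.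
  rewrite dotDl dot_fourier_out ?addr0 //; last exact: gs_orthonormal.
  rewrite gsE -/v dotZr -dot_norm conj_Creal ?rpredV ?normr_real //.
  by rewrite expr2 mulKf.
by rewrite fourierS dn gsE -/v scalerA mulfV // scale1r addrC subrK.
Qed.

(** An element of rank at most n outside the n-th span must be the one picked at
    stage n, since none of smaller rank is left. *)
Lemma spanned n d : D d -> (rank d < n)%N -> d = fourier gs n d.
Proof.
elim: n d => // n IH d Dd; rewrite ltnS => dn.
have [Dp pn least] := gs_pickedP (@gs_orthonormal_upto n).
have [dE|dE] := pselect (d = fourier gs n d); first exact: fourier_fixS.
suff -> : d = gs_picked n by exact: fourier_gs_picked.
apply: rank_inj; rewrite ?inE //; apply/eqP; rewrite eqn_leq least //.
rewrite andbT (leq_trans dn) // leqNgt; apply/negP => pl.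
exact/pn/IH.
Qed.

Lemma gs_onb : onb dot gs.
Proof.
split=> [|x eps e0]; first exact: gs_orthonormal.
have [d Dd xd] := dense_approx x e0; exists (rank d).+1 => n dn.
have -> : x - fourier gs n x = (x - d) - fourier gs n (x - d).
  by rewrite fourierB -(spanned Dd dn) opprB addrA subrK.
by rewrite (le_lt_trans (fourier_bound _ _ _)) //; exact: gs_orthonormal_upto.
Qed.

End GramSchmidt.

Lemma onb_exists (R : realType) (H : completeNormedModType R[i])
  (dot : {dot H for Num.conj}) (dot_norm : forall x : H, `|x| ^+ 2 = dot x x) :
  separable H -> infinite_dimensional H -> exists e, onb dot e.
Proof.
move=> [D /countable_injP[rank rank_inj] denseD] infH.
by exists (gs dot D rank); exact: gs_onb.
Qed.

(** * Adjoints, and isometries moving basis vectors *)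
Section Bop.
Variables (R : realType) (H : completeNormedModType R[i]).
Implicit Types (S T : bop H).

Lemma bop_ext S T : (forall x, S x = T x) -> S = T.
Proof. by move=> ST; apply/val_inj/funext. Qed.

Lemma bopE_mul S T x : (S * T) x = S (T x). Proof. by []. Qed.
Lemma bopE_sub S T x : (S - T) x = S x - T x. Proof. by []. Qed.
Lemma bopE_opp T x : (- T) x = - T x. Proof. by []. Qed.
Lemma bopE_one x : (1 : bop H) x = x. Proof. by []. Qed.
Lemma bopE_zero x : (0 : bop H) x = 0. Proof. by []. Qed.

Lemma bopE_sum I (r : seq I) (F : I -> bop H) x :
  (\sum_(i <- r) F i) x = \sum_(i <- r) F i x.
Proof. by elim/big_rec2: _ => // i y T _ <-. Qed.

Lemma bopD T x y : T (x + y) = T x + T y.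
Proof. by rewrite -[x]scale1r bop_linear !scale1r. Qed.

Lemma bop_rbound T : exists2 M : R, 0 <= M & forall x, rnorm (T x) <= M * rnorm x.
Proof.
have [M M0 HM] := bop_bounded T; exists (complex.Re M).
  by rewrite -lecR RRe_real // ger0_real.
by move=> x; rewrite -lecR rmorphM /= -!rnormE RRe_real ?HM // ger0_real.
Qed.

Lemma bop_of_linear (f : H -> H) (M : R) : linear f ->
  (forall x, rnorm (f x) <= M * rnorm x) -> exists T : bop H, forall x, T x = f x.
Proof.
move=> linf fM; suff bf : f \in @bounded_linear R H by exists (Bop bf).
apply/asboolP; split => //; exists M%:C%C => x.
by rewrite !rnormE -rmorphM lecR.
Qed.

End Bop.

Section Adjoint.
Variables (R : realType) (H : completeNormedModType R[i]).
Variable dot : {dot H for Num.conj}.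
Hypothesis dot_norm : forall x : H, `|x| ^+ 2 = dot x x.
Variable e : nat -> H.
Hypothesis onb_e : onb dot e.
Implicit Types (x y z : H) (S T : bop H).

Local Notation adj := (adjoint dot).

(** The representing vector has coefficients conj (f (e n)). They are
    square-summable because f takes at sum_(i < m) conj (f (e i)) e_i the value
    sum_(i < m) |f (e i)|^2, the square of the norm of that vector. *)
Lemma riesz (f : H -> R[i]) (M : R) : 0 <= M ->
  (forall a x y, f (a *: x + y) = a * f x + f y) ->
  (forall x, `|f x| <= (M * rnorm x)%:C%C) ->
  exists z, forall x, f x = dot x z.
Proof.
move=> M0 linf fM; have [oe ce] := onb_e.
have f0 : f 0 = 0.
  apply/normr0_eq0/eqP; rewrite eq_le normr_ge0 andbT (le_trans (fM 0)) //.
  by rewrite rnorm0 mulr0.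
have f_comb c m : f (\sum_(0 <= i < m) c i *: e i) = \sum_(0 <= i < m) c i * f (e i).
  elim: m => [|m IH]; first by rewrite !big_geq.
  by rewrite !big_nat_recr //= addrC linf IH addrC.
pose c n := (f (e n))^*.
have cM m : \sum_(i < m) sqnorm (c i) <= M ^+ 2.
  rewrite -(big_mkord xpredT (fun i => sqnorm (c i))).
  set s := \sum_(_ <= _ < _) _; have := fM (\sum_(0 <= i < m) c i *: e i).
  have sE : rnorm (\sum_(0 <= i < m) c i *: e i) ^+ 2 = s by rewrite (norm_comb dot_norm).
  have -> : f (\sum_(0 <= i < m) c i *: e i) = s%:C%C.
    rewrite f_comb /s rmorph_sum; apply: eq_bigr => i _ /=.
    by rewrite sqnormE /c normCK conjCK.
  have s0 : 0 <= s by rewrite -sE exprn_ge0 // rnorm_ge0.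
  rewrite ger0_norm ?ler0c // lecR -sE.
  set r := rnorm _; have r0 : 0 <= r := rnorm_ge0 _.
  move=> rM; rewrite ler_sqr ?nnegrE //.
  have [->//|rn0] := eqVneq r 0.
  have rp : 0 < r by rewrite lt_def rn0.
  by rewrite -(ler_pM2r rp) -expr2.
have [z zc _] := l2_synthesis dot_norm oe cM.
exists z => x; apply/subr0_eq.
pose g x := f x - dot x z.
have ge n : g (e n) = 0 by rewrite /g dotC zc /c conjCK subrr.
have gN x' : `|g x'| <= ((M + rnorm z) * rnorm x')%:C%C.
  rewrite (le_trans (ler_normB _ _)) // mulrDl rmorphD lerD // mulrC.
  exact: (cauchy_schwarz_real dot_norm).
have gB x' y' : g (x' - y') = g x' - g y'.
  have fB : f (x' - y') = f x' - f y'.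
    by rewrite -scaleN1r addrC linf mulN1r addrC.
  by rewrite /g fB dotBl; ring.
have gf n : g (fourier dot e n x) = 0.
  rewrite /g /fourier -(big_mkord xpredT (fun i => dot x (e i) *: e i)) f_comb.
  rewrite dot_suml -sumrB big1 // => i _.
  by rewrite dotZl -mulrBr -/(g (e i)) ge mulr0.
rewrite -/(g x); apply: complex_small => eps e0.
have K0 : 0 < M + rnorm z + 1 by rewrite ltr_wpDl // addr_ge0 ?rnorm_ge0.
have [m /(_ m (leqnn m)) Hm] := ce x (eps / (M + rnorm z + 1)) (divr_gt0 e0 K0).
have -> : g x = g (x - fourier dot e m x) by rewrite gB gf subr0.
rewrite (le_trans (gN _)) // lecR.
apply: (@le_trans _ _ ((M + rnorm z + 1) * rnorm (x - fourier dot e m x))).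
  by rewrite ler_wpM2r ?rnorm_ge0 // lerDl.
by rewrite mulrC -ler_pdivlMr // ltW.
Qed.

Lemma adjoint_exists T : exists S : bop H, forall x y, dot (T x) y = dot x (S y).
Proof.
have [M M0 TM] := bop_rbound T.
have /choice[A HA] : forall y, exists z, forall x, dot (T x) y = dot x z.
  move=> y; apply: (@riesz _ (M * rnorm y)) => [||x].
  - by rewrite mulr_ge0 // rnorm_ge0.
  - by move=> a x x'; rewrite bop_linear dotDl dotZl.
  rewrite (le_trans (cauchy_schwarz_real dot_norm _ _)) // lecR mulrAC.
  by rewrite ler_wpM2r ?rnorm_ge0.
have [|y|S SA] := @bop_of_linear _ _ A M.
- move=> a y y'; apply: dot_ext dot_norm _ _ _ => z.
  rewrite dotC -HA dotDr dotZr !HA [in RHS]dotC dotDr dotZr.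
  by rewrite !(rmorphD, rmorphM) /= !conjCK.
- apply: (rnorm_le_self_dot dot_norm (esym (HA y (A y)))).
    by rewrite mulrAC ler_wpM2r ?rnorm_ge0.
  by rewrite mulr_ge0 ?rnorm_ge0.
- by exists S => x y; rewrite SA.
Qed.

Lemma adjointP T x y : dot (T x) y = dot x (adj T y).
Proof. exact: (xgetPex 0 (adjoint_exists T)). Qed.

Lemma adjointPr T x y : dot x (T y) = dot (adj T x) y.
Proof. by rewrite dotC adjointP -dotC. Qed.

Lemma adjoint_unique S T : (forall x y, dot (T x) y = dot x (S y)) -> adj T = S.
Proof.
move=> TS; apply: bop_ext => x; apply: dot_ext dot_norm _ _ _ => y.
by rewrite dotC -adjointP TS -dotC.
Qed.

Lemma adjointK T : adj (adj T) = T.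
Proof. by apply: adjoint_unique => x y; rewrite adjointPr. Qed.

Lemma adjointM S T : adj (S * T) = adj T * adj S.
Proof. by apply: adjoint_unique => x y; rewrite !bopE_mul !adjointP. Qed.

Lemma adjointB S T : adj (S - T) = adj S - adj T.
Proof.
by apply: adjoint_unique => x y; rewrite !bopE_sub dotBl dotBr !adjointP.
Qed.

Lemma adjoint1 : adj 1 = 1.
Proof. exact: adjoint_unique. Qed.

Lemma adjoint0 : adj 0 = 0.
Proof. by apply: adjoint_unique => x y; rewrite !bopE_zero dot0l dot0r. Qed.

Lemma adjoint_bound T (M : R) : 0 <= M ->
  (forall x, rnorm (T x) <= M * rnorm x) -> forall x, rnorm (adj T x) <= M * rnorm x.
Proof.
move=> M0 TM x; apply: (rnorm_le_self_dot dot_norm (esym (adjointP _ _ _))).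
  by rewrite mulrAC ler_wpM2r ?rnorm_ge0.
by rewrite mulr_ge0 ?rnorm_ge0.
Qed.

(** The adjoint is the primitive notion, since its coefficients are read off
    directly: by Bessel's inequality for the subfamily e o f they are
    square-summable. *)
Definition pull (f : nat -> nat) : bop H :=
  xget 0 [set V : bop H | forall x n, dot (V x) (e n) = dot x (e (f n))].

Definition push f : bop H := adj (pull f).

Let e_ext x y := @onb_ext _ _ _ _ x y onb_e.

Lemma pull_exists f : injective f -> exists2 V : bop H,
  forall x n, dot (V x) (e n) = dot x (e (f n)) & forall x, rnorm (V x) <= rnorm x.
Proof.
move=> injf; have [oe _] := onb_e.
have oef : orthonormal_seq dot (e \o f).
  by move=> i j; rewrite /= oe inj_eq.
have /choice[A HA] : forall x, exists z,
    (forall n, dot z (e n) = dot x (e (f n))) /\ rnorm z <= rnorm x.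
  move=> x; have := l2_synthesis (c := fun n => dot x (e (f n))) dot_norm oe
      (fun m => bessel dot_norm m x oef).
  move=> [z zE zx]; exists z; split=> [n|]; first exact: zE.
  by move: zx; rewrite ler_sqr ?nnegrE ?rnorm_ge0.
have [|x|V VE] := @bop_of_linear _ _ A 1.
- move=> a x y; apply: e_ext => n.
  by rewrite dotDl dotZl !(HA _).1 dotDl dotZl.
- by rewrite mul1r (HA x).2.
- by exists V => [x n|x]; rewrite VE; [exact: (HA x).1|exact: (HA x).2].
Qed.

Section Injective.
Variables (f g : nat -> nat).
Hypotheses (injf : injective f) (injg : injective g).

Lemma pullE x n : dot (pull f x) (e n) = dot x (e (f n)).
Proof.
have [V VE _] := pull_exists injf.
suff : [set V : bop H | forall x n, dot (V x) (e n) = dot x (e (f n))] (pull f).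
  exact.
by apply: xgetPex; exists V.
Qed.

Lemma pull_norm x : rnorm (pull f x) <= rnorm x.
Proof.
have [V VE Vn] := pull_exists injf.
suff -> : pull f x = V x by exact: Vn.
by apply: e_ext => n; rewrite pullE VE.
Qed.

Lemma push_norm x : rnorm (push f x) <= rnorm x.
Proof.
rewrite -[leRHS]mul1r adjoint_bound // => y.
by rewrite mul1r pull_norm.
Qed.

Lemma pushE x y : dot (push f x) y = dot x (pull f y).
Proof. by rewrite -adjointPr. Qed.

Lemma pull_e n : pull f (e (f n)) = e n.
Proof.
by have [oe _] := onb_e; apply: e_ext => m; rewrite pullE !oe inj_eq.
Qed.

Lemma pull_e_out k : (forall n, f n <> k) -> pull f (e k) = 0.
Proof.
move=> fk; have [oe _] := onb_e; apply: e_ext => m; rewrite pullE oe dot0l.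
by case: eqP => // kf; case: (fk m).
Qed.

Lemma pullK : pull f * push f = 1.
Proof.
apply: bop_ext => x; apply: e_ext => n.
by rewrite bopE_mul pullE pushE pull_e.
Qed.

End Injective.

Lemma pullM f g : injective f -> injective g -> pull g * pull f = pull (f \o g).
Proof.
move=> injf injg; apply: bop_ext => x; apply: e_ext => n.
by rewrite bopE_mul !pullE //; exact: inj_comp.
Qed.

Lemma pushM f g : injective f -> injective g -> push f * push g = push (f \o g).
Proof. by move=> injf injg; rewrite /push -pullM // adjointM. Qed.

Lemma pull_id : pull id = 1.
Proof. by apply: bop_ext => x; apply: e_ext => n; rewrite pullE. Qed.

Lemma push_id : push id = 1.
Proof. by rewrite /push pull_id adjoint1. Qed.

Lemma pull_push_disjoint f g : injective f -> injective g ->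
  (forall m n, f m <> g n) -> pull f * push g = 0.
Proof.
move=> injf injg fg; apply: bop_ext => x; apply: e_ext => n.
by rewrite bopE_mul pullE // pushE pull_e_out ?dot0r ?dot0l // => m /esym/fg.
Qed.

End Adjoint.

(** * Neumann series *)
Section Neumann.
Variables (R : realType) (H : completeNormedModType R[i]).
Implicit Types (x y z : H) (S T X : bop H).

(** The iterates of x |-> y + X x converge to a solution of x - X x = y, which is
    unique; the solution map is linear and bounded by 2. *)
Lemma neumann X : (forall x, rnorm (X x) <= rnorm x / 2) ->
  exists Y, (1 - X) * Y = 1 /\ Y * (1 - X) = 1.
Proof.
move=> Xhalf.
have half_inj x : x = X x -> x = 0.
  move=> xX; apply: rnorm_eq0; have := Xhalf x; rewrite -xX.
  by have := rnorm_ge0 x; lra.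
have solve y : exists x, x = y + X x.
  pose u := fix u n := if n is m.+1 then y + X (u m) else 0.
  pose r := rnorm y; have r0 : 0 <= r := rnorm_ge0 y.
  have stepu n : rnorm (u n.+1 - u n) <= r * 2^-1 ^+ n.
    elim: n => [|n IH]; first by rewrite /= bop0 addr0 subr0 expr0 mulr1.
    rewrite [u n.+2]/= [u n.+1 in X in _ - X]/= opprD addrACA subrr add0r -bopB.
    by rewrite (le_trans (Xhalf _)) // exprSr mulrA ler_pM2r.
  have tailu n k : rnorm (u (n + k)%N - u n) <= r * 2^-1 ^+ n * 2 * (1 - 2^-1 ^+ k).
    elim: k => [|k IH]; first by rewrite addn0 subrr rnorm0 expr0 subrr mulr0.
    rewrite addnS -(subrK (u (n + k)%N) (u _.+1)) -addrA.
    rewrite (le_trans (rnorm_triangle _ _)) //.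
    have := stepu (n + k)%N; have := IH; rewrite exprD exprS.
    set a := _ ^+ n; set b := _ ^+ k; nra.
  have [|l ul] := complete_seq (u := u).
    move=> eps eps0.
    have Hcvg : (r * 2 * 2^-1 ^+ n) @[n --> \oo] --> (r * 2 * 0 : R).
      apply: cvgMr; apply: cvg_expr.
      by rewrite ger0_norm ?invr_ge0 // invf_lt1 // ltr1n.
    move: Hcvg; rewrite mulr0 => /cvgrPdist_lt/(_ (eps / 2)).
    rewrite divr_gt0 // => /(_ isT)[N _ HN].
    have {}HN : r * 2 * 2^-1 ^+ N < eps / 2.
      have := HN N (leqnn N); rewrite /= sub0r normrN ger0_norm //.
      by rewrite !mulr_ge0 // exprn_ge0.
    have key m : (N <= m)%N -> rnorm (u m - u N) < eps / 2.
      move=> /subnKC <-; apply: le_lt_trans HN.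
      rewrite (le_trans (tailu _ _)) // [r * _ * 2]mulrAC ler_piMr //.
        by rewrite !mulr_ge0 // exprn_ge0.
    exists N => m n Nm Nn; rewrite -(subrK (u N) (u m)) -addrA.
    rewrite (le_lt_trans (rnorm_triangle _ _)) // [ltRHS]splitr ltrD ?key //.
    by rewrite rnormB key.
  exists l; apply: rnorm_small => eps eps0.
  have [N HN] := ul _ (divr_gt0 eps0 (ltr0n _ 2)).
  have -> : l - (y + X l) = - (u N.+1 - l) + X (u N - l).
    by rewrite bopB /= opprB !opprD !addrA subrK.
  rewrite (le_trans (rnorm_triangle _ _)) // rnormN.
  have := HN _ (leqnn N); have := HN _ (leqnSn N); have := Xhalf (u N - l).
  by have := rnorm_ge0 (u N - l); lra.
have /choice[A HA] := solve.
have uniq x y : x = y + X x -> x = A y.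
  move=> xE; apply/subr0_eq/half_inj.
  by rewrite {1}xE {1}(HA y) opprD addrACA subrr add0r -bopB.
have [|x|Y YE] := @bop_of_linear _ _ A 2.
- move=> a x y; apply/esym/uniq.
  by rewrite bop_linear addrACA -scalerDr -!HA.
- have := Xhalf (A x); have := rnorm_triangle x (X (A x)); rewrite -HA.
  lra.
exists Y; split; apply: bop_ext => x.
  by rewrite bopE_mul bopE_sub YE {1}(HA x) addrK.
by rewrite bopE_mul YE; apply/esym/uniq; rewrite bopE_sub subrK.
Qed.

End Neumann.

(** * Compact operators *)
Section Compact.
Variables (R : realType) (H : completeNormedModType R[i]).
Variable dot : {dot H for Num.conj}.
Hypothesis dot_norm : forall x : H, `|x| ^+ 2 = dot x x.
Variable e : nat -> H.
Hypothesis onb_e : onb dot e.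
Implicit Types (x y z : H) (S T : bop H).

Local Notation adj := (adjoint dot).
Local Notation pull := (pull dot e).
Local Notation push := (push dot e).

(** The projection onto the closed span of the e_n with n >= m. *)
Definition tail m : bop H := push (addn m) * pull (addn m).

Lemma addn_inj m : injective (addn m).
Proof. exact: addnI. Qed.

Lemma tailE m x : tail m x = x - fourier dot e m x.
Proof.
have [oe _] := onb_e; apply: (onb_ext onb_e) => n.
rewrite bopE_mul pushE // dotBl; have [mn|nm] := leqP m n.
  rewrite -(subnKC mn) pull_e ?pullE //; try exact: addn_inj.
  by rewrite dot_fourier_out ?subr0 // leq_addr.
rewrite pull_e_out //; first by rewrite dot0r dot_fourier ?subrr // => ? ? _ _.
- exact: addn_inj.
- by move=> k kn; rewrite -kn ltnNge leq_addr in nm.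
Qed.

Lemma tail_norm m x : rnorm (tail m x) <= rnorm x.
Proof.
by rewrite tailE fourier_bound // => i j _ _; case: onb_e.
Qed.

Lemma tail_cvg x (eps : R) : 0 < eps ->
  exists m, forall n, (m <= n)%N -> rnorm (tail n x) < eps.
Proof.
move=> e0; have [_ /(_ x _ e0)[m Hm]] := onb_e; exists m => n mn.
by rewrite tailE Hm.
Qed.

Lemma tail_adjoint m : adj (tail m) = tail m.
Proof. by rewrite (adjointM dot_norm onb_e) /push (adjointK dot_norm onb_e). Qed.

Lemma tail_idem m : tail m * tail m = tail m.
Proof.
rewrite /tail mulrA -(mulrA (push _)) pullK ?mulr1 //; exact: addn_inj.
Qed.

Lemma rnorm_onb i : rnorm (e i) = 1.
Proof.
apply/eqP; rewrite -(@eqrXn2 _ 2) ?rnorm_ge0 // expr1n; apply/eqP.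
by apply: (@complexI R); rewrite (sqr_rnorm dot_norm) (proj1 onb_e) eqxx.
Qed.

Lemma rnorm_comb_le (c : nat -> R[i]) (B : R) n :
  (forall i, (i < n)%N -> `|c i| <= B%:C%C) ->
  rnorm (\sum_(i < n) c i *: e i) <= B * n%:R.
Proof.
elim: n => [|n IH] cB; first by rewrite big_ord0 rnorm0 mulr0.
rewrite big_ord_recr /= (le_trans (rnorm_triangle _ _)) //.
rewrite -[n.+1%:R]natr1 mulrDr mulr1 lerD ?IH // => [i im|].
  by rewrite cB // (leq_trans im).
rewrite rnormZ rnorm_onb mulr1 -lecR RRe_real ?normr_real //.
exact: cB.
Qed.

Lemma rnorm_bop_near T y z :
  rnorm (T y) <= rnorm (T z) + rnorm (T (y - z)).
Proof. by rewrite bopB -[X in rnorm X <= _](subrKC (T z)) rnorm_triangle. Qed.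

(** Uniform smallness of the tails of T, which amounts to compactness
    ([compactP]) and turns questions about compact operators into estimates. *)
Definition fin_approx T := forall eps : R, 0 < eps ->
  exists m, forall x, rnorm (tail m (T x)) <= eps * rnorm x.

Lemma rnormZ_real (r : R) x : 0 <= r -> rnorm (r%:C%C *: x) = r * rnorm x.
Proof. by move=> r0; rewrite rnormZ ger0_norm ?ler0c. Qed.

Lemma unit_ball_bound T (M : R) : 0 <= M ->
  (forall x, `|x| <= 1 -> rnorm (T x) <= M) -> forall x, rnorm (T x) <= M * rnorm x.
Proof.
move=> M0 TM x; have [x0|x0] := eqVneq (rnorm x) 0.
  by rewrite (rnorm_eq0 x0) bop0 rnorm0 mulr0.
have xp : 0 < rnorm x by rewrite lt_def x0 rnorm_ge0.
have := TM ((rnorm x)^-1%:C%C *: x).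
rewrite bopZ rnormZ_real ?invr_ge0 ?rnorm_ge0 // mulrC ler_pdivrMr //; apply.
by rewrite rnormE rnormZ_real ?invr_ge0 ?rnorm_ge0 // mulVf.
Qed.

(** The tails of one vector tend to 0 and are contractive, so near each point of the
    compact set a single m works; a compact set needs only one m altogether. *)
Lemma compact_fin_approx T : T \in compact_op -> fin_approx T.
Proof.
move=> /compact_opE[A /compact_near_coveringP cA TA] eps e0.
have [|m _ Hm] := cA nat \oo (fun m y => rnorm (tail m y) < eps) _.
  move=> y _; have e2 : 0 < eps / 2 by rewrite divr_gt0.
  have [m Hm] := tail_cvg y e2.
  exists (ball y (eps / 2)%:C%C, [set n | (m <= n)%N]).
    split=> /=; first by apply: nbhsx_ballx; rewrite ltr0C.
    exact: nbhs_infty_ge.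
  move=> [y' n] [/= yy' mn]; have := Hm _ mn.
  move: yy'; rewrite -ball_normE /= rnormE ltcR.
  move=> yy' ty /=; have := rnorm_bop_near (tail n) y' y.
  have := tail_norm n (y' - y); rewrite [rnorm (y' - y)]rnormB; lra.
exists m; apply: (@unit_ball_bound (tail m * T)); first exact: ltW.
by move=> x /TA /(Hm m (leqnn m)) /ltW.
Qed.

(** An ultrafilter whose image lies in a segment has a cluster point there, and an
    ultrafilter contains every set that meets all its members. *)
Lemma ultra_real_bounded (F : set_system H) (f : H -> R) (M delta : R) :
  UltraFilter F -> F [set y | `|f y| <= M] -> 0 < delta ->
  exists c, F [set y | `|f y - c| < delta].
Proof.
move=> FU FM d0; have FP : ProperFilter F by exact: ultra_proper.
have [|c [_ clc]] := @segment_compact R (- M) M (f @ F) (fmap_proper_filter f FP).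
  by apply: (@filterS _ F _ _ _ _ FM) => y /=; rewrite ler_norml in_itv.
exists c; have [//|FN] := in_ultra_setVsetC [set y | `|f y - c| < delta] FU.
have [||r [[y]]] := clc (f @` ~` [set y | `|f y - c| < delta]) (ball c delta).
- by apply: (@filterS _ F _ _ _ _ FN) => y; exists y.
- exact: nbhsx_ballx.
- by move=> ny <-; rewrite -ball_normE /= distrC.
Qed.

Lemma ultra_complex_bounded (F : set_system H) (f : H -> R[i]) (M delta : R) :
  UltraFilter F -> F [set y | `|f y| <= M%:C%C] -> 0 < delta ->
  exists c, F [set y | `|f y - c| < delta%:C%C].
Proof.
move=> FU FM d0; have d2 : 0 < delta / 2 by rewrite divr_gt0.
have ReIm (a : R[i]) : `|complex.Re a|%:C%C <= `|a| /\ `|complex.Im a|%:C%C <= `|a|.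
  rewrite normc_def !lecR -!sqrtr_sqr !ler_sqrt ?addr_ge0 ?sqr_ge0 //.
  by rewrite lerDl lerDr !sqr_ge0.
have [|a Fa] := @ultra_real_bounded F (fun y => complex.Re (f y)) M _ FU _ d2.
  by apply: filterS FM => y /= fy; rewrite -lecR (le_trans (ReIm _).1).
have [|b Fb] := @ultra_real_bounded F (fun y => complex.Im (f y)) M _ FU _ d2.
  by apply: filterS FM => y /= fy; rewrite -lecR (le_trans (ReIm _).2).
exists (Complex a b); apply: filterS2 Fa Fb => y /= ya yb.
have -> : f y - Complex a b =
    (complex.Re (f y) - a)%:C%C + 'i%C * (complex.Im (f y) - b)%:C%C.
  by rewrite [LHS]complexE; case: (f y).
rewrite (le_lt_trans (ler_normD _ _)) // normrM !normc_def /=.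
rewrite !expr0n /= !add0r !addr0 !expr1n !sqrtr1 mul1r !sqrtr_sqr.
by rewrite -rmorphD ltcR [ltRHS]splitr ltrD.
Qed.

(** An ultrafilter on the image of the ball is Cauchy: finitely many coordinates
    converge along it, the remaining ones are uniformly small. *)
Lemma fin_approx_compact T : fin_approx T -> T \in compact_op.
Proof.
move=> aT; have [oe _] := onb_e; have [M M0 TM] := bop_rbound T.
apply/asboolP; rewrite precompactE.
set A := T @` _; rewrite compact_ultra => F FU FA.
have FP : ProperFilter F by exact: ultra_proper.
have near_A y (d : R) : closure A y -> 0 < d ->
    exists2 x, rnorm x <= 1 & rnorm (y - T x) < d.
  move=> cy d0; have [|r [[x x1 <-]]] := cy (ball y d%:C%C).
    by apply: nbhsx_ballx; rewrite ltr0C.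
  rewrite -ball_normE /= rnormE ltcR => ?; exists x => //.
  by rewrite -lecR -rnormE.
have /cauchy_cvg Fl : cauchy F.
  apply: cauchy_exP => eps.
  have [->|] := eqVneq eps (complex.Re eps)%:C%C; last first.
    by move=> + e0; rewrite RRe_real ?eqxx // gtr0_real.
  move: (complex.Re eps) => {}eps; rewrite ltr0C => e0.
  have e4 : 0 < eps / 4 by rewrite divr_gt0.
  have [m Hm] := aT _ e4.
  have Ftail : F [set y | rnorm (tail m y) <= eps / 2].
    apply: filterS FA => y /near_A/(_ e4)[x x1 yx] /=.
    have := rnorm_bop_near (tail m) y (T x).
    have := Hm x; have := tail_norm m (y - T x).
    have : eps / 4 * rnorm x <= eps / 4 by rewrite ler_piMr // ltW.
    lra.
  have Fcoef i : F [set y | `|dot y (e i)| <= (M + 1)%:C%C].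
    apply: filterS FA => y /near_A/(_ ltr01)[x x1 yx] /=.
    rewrite (le_trans (cauchy_schwarz_real dot_norm _ _)) // lecR.
    rewrite rnorm_onb mulr1 -(subrK (T x) y) addrC (le_trans (rnorm_triangle _ _)) //.
    by rewrite lerD ?(ltW yx) // (le_trans (TM x)) // ler_piMr.
  have dm : 0 < eps / 2 / m.+1%:R by rewrite !divr_gt0.
  have /choice[c Hc] : forall i, exists c,
      F [set y | `|dot y (e i) - c| < (eps / 2 / m.+1%:R)%:C%C].
    by move=> i; exact: ultra_complex_bounded (Fcoef i) dm.
  exists (\sum_(i < m) c i *: e i).
  have Fall n : F [set y | forall i, (i < n)%N ->
      `|dot y (e i) - c i| < (eps / 2 / m.+1%:R)%:C%C].
    elim: n => [|n IH]; first by apply: filterS FA.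
    apply: filterS2 IH (Hc n) => y /= IHy yn i.
    by rewrite ltnS leq_eqVlt => /predU1P[->//|/IHy].
  apply: filterS2 Ftail (Fall m) => y ty cy.
  rewrite -ball_normE /= rnormE ltcR rnormB.
  have -> : y - \sum_(i < m) c i *: e i =
      tail m y + \sum_(i < m) (dot y (e i) - c i) *: e i.
    rewrite tailE /fourier.
    under [X in _ = _ + X]eq_bigr do rewrite scalerBl.
    by rewrite sumrB addrA subrK.
  rewrite (le_lt_trans (rnorm_triangle _ _)) //.
  have sm : rnorm (\sum_(i < m) (dot y (e i) - c i) *: e i) <=
      eps / 2 / m.+1%:R * m%:R.
    by apply: (rnorm_comb_le (c := fun i => dot y (e i) - c i)) => i /cy/ltW.
  rewrite [ltRHS]splitr ler_ltD //; apply: le_lt_trans sm _.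
  by rewrite mulrAC ltr_pdivrMr // ltr_pM2l ?divr_gt0 // ltr_nat.
exists (lim F); split=> //.
exact: (@closed_cvg _ _ F FP id _ (@closed_closure _ A) FA _ Fl).
Qed.

Lemma compactP T : T \in compact_op <-> fin_approx T.
Proof. by split; [exact: compact_fin_approx|exact: fin_approx_compact]. Qed.

End Compact.

Section CompactIdeal.
Variables (R : realType) (H : completeNormedModType R[i]).
Variable dot : {dot H for Num.conj}.
Hypothesis dot_norm : forall x : H, `|x| ^+ 2 = dot x x.
Variable e : nat -> H.
Hypothesis onb_e : onb dot e.
Implicit Types (x y z : H) (S T : bop H).

Local Notation adj := (adjoint dot).
Local Notation tail := (tail dot e).

Lemma compact_closed_norm T :
  (forall eps : R, 0 < eps -> exists2 K, K \in compact_op &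
     forall x, rnorm ((T - K) x) <= eps * rnorm x) ->
  T \in compact_op.
Proof.
move=> appT; apply/(compactP dot_norm onb_e) => eps e0.
have [K /(compactP dot_norm onb_e) cK TK] := appT _ (divr_gt0 e0 (ltr0n _ 2)).
have [m Km] := cK _ (divr_gt0 e0 (ltr0n _ 2)).
exists m => x; have := rnorm_bop_near (tail m) (T x) (K x).
have := tail_norm dot_norm onb_e m (T x - K x); have := TK x; have := Km x.
rewrite bopE_sub; lra.
Qed.

Lemma compact_finite_range m T : tail m * T = 0 -> T \in compact_op.
Proof.
move=> mT; apply/(compactP dot_norm onb_e) => eps e0; exists m => x.
by rewrite -bopE_mul mT rnorm0 mulr_ge0 ?rnorm_ge0 // ltW.
Qed.

(** With u = tail m (T^* x) one has |u|^2 = <x, T u>, so it is enough to make T u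
    small compared with u. The part of T u beyond n is small by compactness; its
    coordinate i < n is <u, tail m (T^* e_i)>, small when m is large. *)
Lemma compact_adjoint T : T \in compact_op -> adj T \in compact_op.
Proof.
move=> /(compactP dot_norm onb_e) cT; apply/(compactP dot_norm onb_e) => eps e0.
have e2 : 0 < eps / 2 by rewrite divr_gt0.
have [n Hn] := cT _ e2.
have dn : 0 < eps / 2 / n.+1%:R by rewrite divr_gt0.
have [m Hm] : exists m, forall i, (i < n)%N ->
    rnorm (tail m (adj T (e i))) <= eps / 2 / n.+1%:R.
  suff : exists m, forall i k, (i < n)%N -> (m <= k)%N ->
      rnorm (tail k (adj T (e i))) <= eps / 2 / n.+1%:R.
    by move=> [m Hm]; exists m => i /Hm; apply.
  move: (eps / 2 / _) dn => d dn.
  elim: {Hn}n => [|k [m Hm]]; first by exists 0%N.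
  have [p Hp] := tail_cvg dot_norm onb_e (adj T (e k)) dn.
  exists (maxn m p) => i l; rewrite ltnS leq_eqVlt geq_max.
  by move=> /predU1P[->|ik] /andP[ml pl]; [exact/ltW/Hp|exact: Hm].
exists m => x; set u := tail m (adj T x).
have tu : tail m u = u by rewrite /u -bopE_mul tail_idem.
have Tu : rnorm (T u) <= eps * rnorm u.
  have -> : T u = tail n (T u) + fourier dot e n (T u).
    by rewrite tailE // subrK.
  rewrite (le_trans (rnorm_triangle _ _)) // {1}(splitr eps) mulrDl lerD //.
  apply: (@le_trans _ _ (eps / 2 / n.+1%:R * rnorm u * n%:R)).
    apply: (rnorm_comb_le dot_norm onb_e (c := fun i => dot (T u) (e i))) => i im.
    rewrite (adjointP dot_norm onb_e) -{1}tu (adjointP dot_norm onb_e).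
    rewrite tail_adjoint // (le_trans (cauchy_schwarz_real dot_norm _ _)) //.
    by rewrite lecR mulrC ler_wpM2r ?rnorm_ge0 // Hm.
  rewrite mulrAC ler_wpM2r ?rnorm_ge0 // mulrAC ler_pdivrMr //.
  by rewrite ler_wpM2l ?ler_nat // ltW.
have uu : dot u u = dot x (T u).
  rewrite {1}/u (adjointP dot_norm onb_e) tail_adjoint // tu.
  by rewrite -(adjointPr dot_norm onb_e).
apply: (rnorm_le_self_dot dot_norm uu).
  by rewrite (mulrC eps) -mulrA ler_wpM2l ?rnorm_ge0.
by rewrite mulr_ge0 ?rnorm_ge0 // ltW.
Qed.

Lemma compact_finite_corange m T : T * tail m = 0 -> T \in compact_op.
Proof.
move=> Tm; rewrite -(adjointK dot_norm onb_e T) compact_adjoint //.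
apply: (@compact_finite_range m).
by rewrite -tail_adjoint // -(adjointM dot_norm onb_e) Tm (adjoint0 dot_norm onb_e).
Qed.

End CompactIdeal.

(** * The Calkin algebra: classes, involution and norm *)
Section OpNorm.
Variables (R : realType) (H : completeNormedModType R[i]).
Implicit Types (x y z : H) (S T : bop H).

Lemma opnorm_le T (M : R) : 0 <= M ->
  (forall x, rnorm (T x) <= M * rnorm x) -> opnorm T <= M.
Proof.
move=> M0 TM; apply: ge_sup; first by exists (rnorm (T 0)), 0; rewrite /= ?normr0.
move=> _ [x /= x1 <-]; rewrite (le_trans (TM x)) // ler_piMr //.
by rewrite -lecR -rnormE.
Qed.

Lemma opnorm_bound T x : rnorm (T x) <= opnorm T * rnorm x.
Proof.
have [M M0 TM] := bop_rbound T.
have ub y : `|y| <= 1 -> rnorm (T y) <= opnorm T.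
  move=> y1; apply: ub_le_sup; last by exists y.
  exists M => _ [z /= z1 <-]; rewrite (le_trans (TM z)) // ler_piMr //.
  by rewrite -lecR -rnormE.
apply: unit_ball_bound => //.
by rewrite (le_trans (rnorm_ge0 (T 0))) // ub // normr0.
Qed.

Lemma opnorm_ge0 T : 0 <= opnorm T.
Proof.
have [M M0 TM] := bop_rbound T.
rewrite (le_trans (rnorm_ge0 (T 0))) //; apply: ub_le_sup.
  exists M => _ [z /= z1 <-]; rewrite (le_trans (TM z)) // ler_piMr //.
  by rewrite -lecR -rnormE.
by exists 0; rewrite /= ?normr0.
Qed.

End OpNorm.

Section CalkinNorm.
Local Open Scope quotient_scope.
Variables (R : realType) (H : completeNormedModType R[i]).
Variable dot : {dot H for Num.conj}.
Hypothesis dot_norm : forall x : H, `|x| ^+ 2 = dot x x.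
Variable e : nat -> H.
Hypothesis onb_e : onb dot e.
Implicit Types (S T U V : bop H) (p q : calkin dot).

Local Notation adj := (adjoint dot).

Definition cls T : calkin dot := \pi_(calkin dot) T.

Lemma clsP p : exists T, p = cls T.
Proof. by exists (repr p); rewrite /cls reprK. Qed.

Lemma cls_eqP S T : reflect (cls S = cls T) (S - T \in compact_op).
Proof. exact: calkin_eqP. Qed.

Lemma clsD S T : cls (S + T) = cls S + cls T.
Proof. exact: pi_calkinD. Qed.

Lemma clsM S T : cls (S * T) = cls S * cls T.
Proof. exact: pi_calkinM. Qed.

Lemma clsZ a T : cls (a *: T) = a *: cls T.
Proof. exact: pi_calkinZ. Qed.

Lemma cls1 : cls 1 = 1.
Proof. by []. Qed.

Lemma cls0 : cls 0 = 0.
Proof. by apply: (addIr (cls 0)); rewrite -clsD !add0r. Qed.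

Lemma clsB S T : cls (S - T) = cls S - cls T.
Proof. by apply: (addIr (cls T)); rewrite -clsD !subrK. Qed.

Lemma cls_sum I (r : seq I) (F : I -> bop H) :
  cls (\sum_(i <- r) F i) = \sum_(i <- r) cls (F i).
Proof. exact: (big_morph _ clsD cls0). Qed.

Lemma clsX T n : cls (T ^+ n) = cls T ^+ n.
Proof. by elim: n => // n IH; rewrite !exprS clsM IH. Qed.

(** Passing to the adjoint of the chosen representative is harmless because
    adjoints of compact operators are compact. *)
Lemma cls_star T : star (cls T) = cls (adj T).
Proof.
rewrite [star _]/(calkin_star _) /calkin_star; apply/cls_eqP.
rewrite -(adjointB dot_norm onb_e) (compact_adjoint dot_norm onb_e) //.
by apply/cls_eqP; rewrite /cls reprK.
Qed.

Lemma cnormE p : cnorm p = inf [set opnorm T | T in [set T | cls T = p]].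
Proof. by []. Qed.

Lemma cnorm_has_inf p : has_inf [set opnorm T | T in [set T | cls T = p]].
Proof.
split; last by exists 0 => _ [T _ <-]; exact: opnorm_ge0.
by have [T pT] := clsP p; exists (opnorm T), T.
Qed.

Lemma cnorm_le T : cnorm (cls T) <= opnorm T.
Proof. by apply: ge_inf; [exact: (cnorm_has_inf _).2|exists T]. Qed.

Lemma cnorm_zero : cnorm (0 : calkin dot) <= 0.
Proof.
rewrite -cls0 (le_trans (cnorm_le _)) // opnorm_le // => x.
by rewrite bopE_zero rnorm0 mul0r.
Qed.

(** A class at distance 0 from the compact operators is 0 as these form a closed
    set. This is what makes conditions of the form |t| <= 0 express equations. *)
Lemma cnorm_eq0 p : cnorm p <= 0 -> p = 0.
Proof.
have [T ->] := clsP p => T0; rewrite -cls0; apply/cls_eqP; rewrite subr0.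
apply: (compact_closed_norm dot_norm onb_e) => eps e0.
have [_ [S /= ST <-] Se] := inf_adherent e0 (cnorm_has_inf (cls T)).
exists (T - S); first by apply/cls_eqP; rewrite ST.
move=> x; rewrite subKr (le_trans (opnorm_bound _ _)) // ler_wpM2r ?rnorm_ge0 //.
by rewrite -cnormE in Se; rewrite (le_trans (ltW Se)) // gerDr.
Qed.

Lemma cnorm_contract U V p :
  (forall x, rnorm (U x) <= rnorm x) -> (forall x, rnorm (V x) <= rnorm x) ->
  cnorm (cls U * p * cls V) <= cnorm p.
Proof.
move=> Uc Vc; apply: lb_le_inf; first exact: (cnorm_has_inf _).1.
move=> _ [T /= <- <-]; rewrite -!clsM (le_trans (cnorm_le _)) //.
apply: opnorm_le => [|x]; first exact: opnorm_ge0.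
rewrite !bopE_mul (le_trans (Uc _)) // (le_trans (opnorm_bound _ _)) //.
by rewrite ler_wpM2l ?opnorm_ge0.
Qed.

End CalkinNorm.

(** * Amplification along a partition of unity into isometries *)
Section Amplification.
Variables (A : pzRingType) (N : nat) (s v : 'I_N -> A).
Hypothesis vs : forall i j, v i * s j = (i == j)%:R.
Hypothesis sv : \sum_i s i * v i = 1.

Definition amp t := \sum_i s i * t * v i.

Lemma amp1 : amp 1 = 1.
Proof. by rewrite -[RHS]sv; apply: eq_bigr => i _; rewrite mulr1. Qed.

Lemma ampM t u : amp (t * u) = amp t * amp u.
Proof.
rewrite /amp mulr_suml; apply: eq_bigr => i _.
rewrite mulr_sumr (bigD1 i) //= big1 ?addr0 => [|j ji].
  by rewrite !mulrA -[_ * v i * s i]mulrA vs eqxx mulr1.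
by rewrite !mulrA -[_ * v i * s j]mulrA vs eq_sym (negPf ji) mulr0 !mul0r.
Qed.

Lemma ampX t k : amp (t ^+ k) = amp t ^+ k.
Proof. by elim: k => [|k IH]; rewrite ?amp1 // !exprS ampM IH. Qed.

Lemma amp_intertwine x y : (forall i, y * s i = s i * x) -> amp x = y.
Proof.
move=> ys; rewrite -[RHS]mulr1 -sv mulr_sumr.
by apply: eq_bigr => i _; rewrite mulrA ys.
Qed.

Lemma amp_intertwine_r x y : (forall i, v i * y = x * v i) -> amp x = y.
Proof.
move=> ys; rewrite -[RHS]mul1r -sv mulr_suml.
by apply: eq_bigr => i _; rewrite -!mulrA ys.
Qed.

(** Commuting with the row i0 of the matrix units s_i v_j makes x block diagonal,
    with all its blocks equal to the one at i0. *)
Lemma amp_commutant i0 x : (forall i, x * (s i0 * v i) = (s i0 * v i) * x) ->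
  amp (v i0 * x * s i0) = x.
Proof.
move=> xE; rewrite -[RHS]mul1r -sv mulr_suml; apply: eq_bigr => i _.
by rewrite -!mulrA xE !mulrA -[_ * v i0 * s i0]mulrA vs eqxx mulr1.
Qed.

End Amplification.

(** * Lifting invertible classes to invertible operators *)
Section Shift.
Variables (R : realType) (H : completeNormedModType R[i]).
Variable dot : {dot H for Num.conj}.
Hypothesis dot_norm : forall x : H, `|x| ^+ 2 = dot x x.
Variable e : nat -> H.
Hypothesis onb_e : onb dot e.
Implicit Types (x y z : H) (S T A B L V : bop H) (u : calkin dot).

Local Notation adj := (adjoint dot).
Local Notation tail := (tail dot e).
Local Notation pull := (pull dot e).
Local Notation push := (push dot e).
Local Notation cls := (cls dot).

Definition shift : bop H := push (addn 1).
Definition unshift : bop H := pull (addn 1).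
Definition qshift : calkin dot := cls shift.
Definition qunshift : calkin dot := cls unshift.

Lemma shiftX k : shift ^+ k = push (addn k).
Proof.
elim: k => [|k IH]; first by rewrite expr0 -(push_id dot_norm onb_e).
by rewrite exprS IH (pushM dot_norm onb_e (@addn_inj 1) (@addn_inj k)).
Qed.

Lemma unshiftX k : unshift ^+ k = pull (addn k).
Proof.
elim: k => [|k IH]; first by rewrite expr0 -(pull_id dot_norm onb_e).
by rewrite exprSr IH (pullM dot_norm onb_e (@addn_inj 1) (@addn_inj k)).
Qed.

Lemma unshiftK k : unshift ^+ k * shift ^+ k = 1.
Proof. by rewrite shiftX unshiftX pullK //; exact: addn_inj. Qed.

Lemma unshiftK1 : unshift * shift = 1.
Proof. by have := unshiftK 1; rewrite !expr1. Qed.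

Lemma tail_shift k : tail k = shift ^+ k * unshift ^+ k.
Proof. by rewrite shiftX unshiftX. Qed.

Lemma one_sub_tail_compact m : 1 - tail m \in compact_op.
Proof.
apply: (compact_finite_range dot_norm onb_e (m := m)).
by rewrite mulrBr mulr1 tail_idem // subrr.
Qed.

Lemma qunshiftK : qunshift * qshift = 1.
Proof. by rewrite /qshift /qunshift -clsM unshiftK1. Qed.

Lemma qshiftK : qshift * qunshift = 1.
Proof.
rewrite /qshift /qunshift -clsM; have := tail_shift 1; rewrite !expr1 => <-.
apply/esym/cls_eqP.
exact: one_sub_tail_compact.
Qed.

Lemma cls_shiftX k : cls (shift ^+ k) = qshift ^+ k.
Proof. exact: clsX. Qed.
Lemma cls_unshiftX k : cls (unshift ^+ k) = qunshift ^+ k.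
Proof. exact: clsX. Qed.

Lemma qunshiftKX k : qunshift ^+ k * qshift ^+ k = 1.
Proof. by rewrite -cls_shiftX -cls_unshiftX -clsM unshiftK. Qed.

Lemma qshiftKX k : qshift ^+ k * qunshift ^+ k = 1.
Proof.
elim: k => [|k IH]; first by rewrite !expr0 mulr1.
by rewrite exprS exprSr mulrA -(mulrA qshift) IH mulr1 qshiftK.
Qed.

(** The classes of Fredholm operators of index 0. *)
Definition liftable u := exists V V', [/\ V * V' = 1, V' * V = 1 & u = cls V].

Lemma liftableM u1 u2 : liftable u1 -> liftable u2 -> liftable (u1 * u2).
Proof.
move=> [V [V' [VV' V'V ->]]] [U [U' [UU' U'U ->]]]; exists (V * U), (U' * V').
split; last by rewrite clsM.
- by rewrite mulrA -(mulrA V) UU' mulr1.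
- by rewrite mulrA -(mulrA U') V'V mulr1.
Qed.

Lemma liftable_inv u1 u2 : liftable u1 -> u2 * u1 = 1 -> liftable u2.
Proof.
move=> [V [V' [VV' V'V ->]]] u2V; exists V', V; split=> //.
by rewrite -[u2]mulr1 -(cls1 dot) -VV' clsM mulrA u2V mul1r.
Qed.

Lemma rank_one (f : H) (g : H -> R[i]) (M : R) : 0 <= M ->
  (forall a x y, g (a *: x + y) = a * g x + g y) ->
  (forall x, `|g x| <= (M * rnorm x)%:C%C) ->
  exists F : bop H, forall x, F x = g x *: f.
Proof.
move=> M0 lg gM; apply: (@bop_of_linear _ _ _ (M * rnorm f)).
  by move=> a x y; rewrite lg scalerDl scalerA.
move=> x; rewrite rnormZ mulrAC ler_wpM2r ?rnorm_ge0 // -lecR.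
by rewrite RRe_real ?normr_real // gM.
Qed.

Lemma rank_one_dot T z f : exists F : bop H, forall x, F x = dot (T x) z *: f.
Proof.
have [M M0 TM] := bop_rbound T.
apply: (@rank_one _ _ (M * rnorm z)) => [|a x y|x].
- by rewrite mulr_ge0 ?rnorm_ge0.
- by rewrite bop_linear dotDl dotZl.
rewrite (le_trans (cauchy_schwarz_real dot_norm _ _)) // lecR mulrAC.
by rewrite ler_wpM2r ?rnorm_ge0.
Qed.

Lemma tailS m x : tail m x = tail m.+1 x + dot x (e m) *: e m.
Proof.
by rewrite !(tailE dot_norm onb_e) fourierS opprD addrA subrK.
Qed.

Lemma unshift_e0 : unshift (e 0%N) = 0.
Proof. by apply: (pull_e_out dot_norm onb_e) => //; exact: addn_inj. Qed.

(** If A has a left inverse L and the cokernel projection E = 1 - A L has range in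
    the span of e_0, ..., e_(m-1), then A becomes invertible after r back-shifts and
    a compact perturbation, r being the dimension of that cokernel. One dimension
    is absorbed at a time: pick f in the range of E with e_(m-1)-coordinate 1, let
    A' act as A after a back-shift, and send the freed vector e_0 to f. *)
Lemma liftable_of_left_inverse m A L : L * A = 1 -> tail m * (1 - A * L) = 0 ->
  exists r, liftable (cls A * qunshift ^+ r).
Proof.
elim: m A L => [|m IH] A L LA.
  rewrite tail_shift !expr0 !mul1r => /subr0_eq/esym AL.
  by exists 0%N, A, L; rewrite expr0 mulr1.
set E := 1 - A * L => mE.
have [E0|] := pselect (forall x, dot (E x) (e m) = 0).
  apply: (IH A L) => //; apply: bop_ext => x; rewrite bopE_mul tailS -/E.
  by rewrite -bopE_mul mE E0 scale0r addr0.
move=> /existsNP[g /eqP g0].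
have EA : E * A = 0 by rewrite mulrBl mul1r -mulrA LA mulr1 subrr.
have LE : L * E = 0 by rewrite mulrBr mulr1 mulrA LA mul1r subrr.
have EE : E * E = E by rewrite {1}/E mulrBl mul1r -mulrA LE mulr0 subr0.
have Ex x : E x = x - A (L x) by [].
clearbody E.
pose f := (dot (E g) (e m))^-1 *: E g.
have Ef : E f = f by rewrite /f bopZ -bopE_mul EE.
have fm : dot f (e m) = 1 by rewrite /f dotZl mulVf.
have Lf : L f = 0 by rewrite -Ef -bopE_mul LE.
clearbody f.
have [oe _] := onb_e.
have [F FE] := rank_one_dot 1 (e 0%N) f.
have [G GE] := rank_one_dot E (e m) (e 0%N).
pose A' := A * unshift + F; pose L' := shift * L + G.
have shift0 x : dot (shift x) (e 0%N) = 0.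
  rewrite (pushE dot_norm onb_e) ?unshift_e0 ?dot0r //; exact: addn_inj.
have A'E x : A' x = A (unshift x) + dot x (e 0%N) *: f by rewrite -FE.
have L'E x : L' x = shift (L x) + dot (E x) (e m) *: e 0%N by rewrite -GE.
have t1 x : shift (unshift x) + dot x (e 0%N) *: e 0%N = x.
  have := tailE dot_norm onb_e 1 x; rewrite tail_shift !expr1 bopE_mul => ->.
  by rewrite /fourier big_ord1 subrK.
have LA' : L' * A' = 1.
  (* A' maps e_0 to f and G recovers e_0 from the e_m-coordinate of f. *)
  apply: bop_ext => x; rewrite bopE_mul L'E A'E !bopD !bopZ Lf Ef bop0 scaler0 addr0.
  rewrite -(bopE_mul L) LA -(bopE_mul E) EA bopE_one bopE_zero add0r dotZl fm.
  by rewrite mulr1 t1.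
have mE' : tail m * (1 - A' * L') = 0.
  (* The new cokernel projection subtracts the multiple of f which cancels the
     e_m-coordinate. *)
  have E'E x : (1 - A' * L') x = E x - dot (E x) (e m) *: f.
    rewrite bopE_sub bopE_mul A'E L'E bopE_one !bopD !bopZ.
    rewrite unshift_e0 !bop0 !scaler0 !addr0.
    rewrite dotDl shift0 add0r dotZl oe eqxx mulr1 -(bopE_mul unshift).
    by rewrite unshiftK1 bopE_one opprD addrA -Ex.
  apply: bop_ext => x; rewrite bopE_mul E'E bopE_zero tailS dotBl dotZl fm mulr1.
  rewrite subrr scale0r addr0 bopB bopZ -Ef -!(bopE_mul _ E) mE !bopE_zero.
  by rewrite scaler0 subr0.
have cA' : cls A' = cls A * qunshift.
  rewrite /A' clsD clsM -[RHS]addr0; congr (_ + _).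
  rewrite -(cls0 dot); apply/(cls_eqP dot); rewrite subr0.
  apply: (compact_finite_corange dot_norm onb_e (m := 1)).
  apply: bop_ext => x; rewrite bopE_mul FE bopE_one tail_shift !expr1 bopE_mul.
  by rewrite shift0 scale0r.
have [r] := IH _ _ LA' mE'; rewrite cA' -mulrA -exprS.
by exists r.+1.
Qed.

Lemma tail_e m k : (k < m)%N -> tail m (e k) = 0.
Proof.
move=> km; have [oe _] := onb_e; apply: (onb_ext onb_e) => n.
rewrite (tailE dot_norm onb_e) dotBl dot0l; have [mn|nm] := leqP m n.
  by rewrite dot_fourier_out // oe ltn_eqF ?subr0 // (leq_trans km).
by rewrite dot_fourier ?subrr // => i j _ _.
Qed.

(** A, and therefore L, only changes the first m coordinates. Hence both map the
    span of e_0, ..., e_(m-1) to itself, the kernel of A lies in that span, and the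
    right inverse of a square matrix is a left inverse. *)
Lemma finite_right_inverse_inj m A L : tail m * A = tail m -> A * L = 1 ->
  forall x, A x = 0 -> x = 0.
Proof.
move=> mA AL x Ax0; have [oe _] := onb_e.
have mL : tail m * L = tail m by rewrite -[in LHS]mA -mulrA AL mulr1.
have four y : tail m y = 0 -> y = \sum_(j < m) dot y (e j) *: e j.
  by rewrite (tailE dot_norm onb_e) => /subr0_eq.
have Afour y i : tail m y = 0 ->
    dot (A y) (e i) = \sum_(j < m) dot y (e j) * dot (A (e j)) (e i).
  move=> /four yE; rewrite {1}yE (big_morph A (bopD A) (bop0 A)) dot_suml.
  by apply: eq_bigr => j _; rewrite bopZ dotZl.
pose MA : 'M[R[i]]_m := \matrix_(i, j) dot (A (e j)) (e i).
pose ML : 'M[R[i]]_m := \matrix_(i, j) dot (L (e j)) (e i).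
have MAL : MA *m ML = 1%:M.
  apply/matrixP => i k; rewrite !mxE.
  have -> : (i == k)%:R = dot ((1 : bop H) (e k)) (e i).
    by rewrite bopE_one oe eq_sym.
  rewrite -AL bopE_mul Afour -?bopE_mul ?mL ?tail_e //.
  by apply: eq_bigr => j _; rewrite !mxE mulrC.
have mx : tail m x = 0 by rewrite -mA bopE_mul Ax0 bop0.
pose xi : 'cV[R[i]]_m := \col_j dot x (e j).
have xi0 : xi = 0.
  rewrite -[xi]mul1mx -(mulmx1C MAL) -mulmxA.
  suff -> : MA *m xi = 0 by rewrite mulmx0.
  apply/matrixP => i k; rewrite !mxE -[RHS](dot0l dot (e i)) -Ax0 Afour //.
  by apply: eq_bigr => j _; rewrite !mxE mulrC.
rewrite (four _ mx) big1 // => j _.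
have := congr1 (fun M : 'cV_m => M j ord0) xi0; rewrite !mxE => ->.
by rewrite scale0r.
Qed.

(** The tail of a compact operator is small enough for the Neumann series. *)
Lemma compact_neumann K : K \in compact_op -> exists m Y,
  (1 - tail m * K) * Y = 1 /\ Y * (1 - tail m * K) = 1.
Proof.
move=> /(compactP dot_norm onb_e)/(_ (2^-1))[|m Hm]; first by rewrite invr_gt0.
exists m; apply: neumann => x; rewrite mulrC; exact: Hm.
Qed.

(** The Fredholm alternative: dividing 1 - K by the invertible operator
    1 - tail m K leaves a perturbation of 1 with range in a finite span. *)
Lemma fredholm_inj K L : K \in compact_op -> (1 - K) * L = 1 ->
  forall x, (1 - K) x = 0 -> x = 0.
Proof.
move=> /compact_neumann[m [Y]]; set X := 1 - tail m * K => -[XY YX] KL x Kx0.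
have YXx z : Y (X z) = z by rewrite -bopE_mul YX.
rewrite -(YXx x); suff -> : X x = 0 by rewrite bop0.
apply: (@finite_right_inverse_inj m ((1 - K) * Y) (X * L)).
- have -> : 1 - K = X - (1 - tail m) * K.
    by rewrite /X mulrBl mul1r opprB addrA subrK.
  rewrite mulrBl XY mulrBr mulr1 !mulrA mulrBr mulr1 tail_idem //.
  by rewrite subrr !mul0r subr0.
- by rewrite mulrA -(mulrA (1 - K)) YX mulr1.
- by rewrite bopE_mul YXx.
Qed.

(** Were V an invertible lift, w^(-k) V would be a compact perturbation of 1 with a
    right inverse, hence injective; but it kills the preimage of e_0 under V. *)
Lemma shift_not_liftable k : (0 < k)%N -> ~ liftable (qshift ^+ k).
Proof.
move=> k0 [V [V' [VV' V'V /esym]]]; rewrite -cls_shiftX => /cls_eqP cK.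
pose K := - (unshift ^+ k * (V - shift ^+ k)).
have KE : 1 - K = unshift ^+ k * V.
  by rewrite /K opprK mulrBr unshiftK addrC subrK.
have Kc : K \in compact_op by rewrite rpredN compact_opMl.
have KL : (1 - K) * (V' * shift ^+ k) = 1.
  by rewrite KE mulrA -(mulrA _ V) VV' mulr1 unshiftK.
have [oe _] := onb_e.
have V'e : V' (e 0%N) = 0.
  apply: (fredholm_inj Kc KL); rewrite KE bopE_mul -(bopE_mul V) VV' bopE_one.
  rewrite unshiftX (pull_e_out dot_norm onb_e) //; first exact: addn_inj.
  by move=> n; case: (k) k0.
have := oe 0%N 0%N; rewrite eqxx -[X in dot X _]/((1 : bop H) (e 0%N)) -VV'.
by rewrite bopE_mul V'e bop0 dot0l => /eqP; rewrite eq_sym oner_eq0.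
Qed.

(** From lifts T S = 1 + K: back-shifting far enough makes K small, so that
    B = unshift^n T has a right inverse Q. The projection E = 1 - Q B is compact, and
    multiplying Q by the invertible 1 - tail m E pushes its range into a finite span,
    where [liftable_of_left_inverse] applies. *)
Lemma fredholm_liftable u v : u * v = 1 -> v * u = 1 ->
  exists a b, liftable (qshift ^+ a * qunshift ^+ b * u).
Proof.
have [T ->] := clsP u; have [S ->] := clsP v => TS ST.
have cK : T * S - 1 \in compact_op.
  by apply/(cls_eqP dot); rewrite clsM TS.
have h2 : (0 : R) < 2^-1 by rewrite invr_gt0.
have [n Hn] := (compactP dot_norm onb_e _).1 cK _ h2.
pose X := - (unshift ^+ n * (T * S - 1) * shift ^+ n).
have [|Y [XY _]] := @neumann _ _ X.
  move=> x; rewrite /X bopE_opp rnormN !bopE_mul.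
  (* unshift^n only sees the tail beyond n, where T S - 1 is small. *)
  have -> : unshift ^+ n = unshift ^+ n * tail n.
    by rewrite tail_shift mulrA unshiftK mul1r.
  rewrite bopE_mul unshiftX.
  rewrite (le_trans (pull_norm dot_norm onb_e (@addn_inj n) _)) //.
  rewrite (le_trans (Hn _)) // mulrC ler_wpM2r // shiftX.
  exact: (push_norm dot_norm onb_e (@addn_inj n)).
pose B := unshift ^+ n * T; pose Q := S * shift ^+ n * Y.
have BQ : B * Q = 1.
  rewrite -XY /B /Q !mulrA; congr (_ * Y).
  rewrite /X opprK mulrBr mulr1 mulrBl unshiftK addrC subrK.
  by rewrite !mulrA.
have cB : cls B = qunshift ^+ n * cls T by rewrite /B clsM cls_unshiftX.
have BV : cls B * (cls S * qshift ^+ n) = 1.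
  by rewrite cB mulrA -(mulrA _ (cls T)) TS mulr1 qunshiftKX.
have VB : (cls S * qshift ^+ n) * cls B = 1.
  by rewrite cB mulrA -(mulrA (cls S)) qshiftKX mulr1 ST.
have QV : cls Q = cls S * qshift ^+ n.
  by rewrite -[LHS]mul1r -VB -mulrA -clsM BQ cls1 mulr1.
pose E := 1 - Q * B.
have EE : E * E = E.
  have QBQB : Q * B * (Q * B) = Q * B by rewrite mulrA -(mulrA Q) BQ mulr1.
  by rewrite /E mulrBl mul1r mulrBr mulr1 QBQB subrr subr0.
have cE : E \in compact_op.
  by rewrite -[E]subr0; apply/(cls_eqP dot); rewrite /E clsB clsM QV VB cls0 cls1 subrr.
have [m [Y2]] := compact_neumann cE.
move X2E : (1 - _) => X2 [XY2 YX2].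
have [||r] := @liftable_of_left_inverse m (X2 * Q) (B * Y2).
- by rewrite mulrA -(mulrA B) YX2 mulr1.
- have -> : 1 - X2 * Q * (B * Y2) = X2 * E * Y2.
    by rewrite /E mulrBr mulr1 mulrBl XY2 !mulrA.
  have -> : X2 * E = E - tail m * E by rewrite -X2E mulrBl mul1r -mulrA EE.
  by rewrite mulrA mulrBr mulrA tail_idem // subrr mul0r.
have -> : cls (X2 * Q) = cls Q.
  rewrite clsM [cls X2](_ : _ = 1) ?mul1r // -cls1; apply/(cls_eqP dot).
  by rewrite -X2E addrC addKr rpredN compact_opMl.
move=> lift; exists r, n; apply: (liftable_inv lift).
by rewrite -[_ * cls T]mulrA -cB QV mulrA -(mulrA _ (cls B)) BV mulr1 qshiftKX.
Qed.

End Shift.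

(** * Automorphisms and types *)
Section Automorphism.
Variables (R : realType) (C : cstarSigType R).

Record automorphism (f g : C -> C) : Prop := Automorphism {
  autK : cancel f g;
  autKV : cancel g f;
  autD : {morph f : x y / x + y};
  autM : {morph f : x y / x * y};
  aut1 : f 1 = 1;
  autZ : forall a, {morph f : x / Defs.cscale a x};
  aut_star : {morph f : x / star x};
  aut_norm : forall x, cnorm (f x) = cnorm x
}.

Section Interp.
Variables (f g : C -> C) (fg : automorphism f g) (V : eqType).
Implicit Types (v : V -> C) (phi : formula R V).

Lemma aut0 : f 0 = 0.
Proof. by apply: (addIr (f 0)); rewrite -(autD fg) !add0r. Qed.

Lemma starpoly_eval_aut v p : starpoly_eval (f \o v) p = f (starpoly_eval v p).
Proof.
rewrite /starpoly_eval (big_morph f (autD fg) aut0); apply: eq_bigr => m _.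
rewrite (autZ fg) (big_morph f (autM fg) (aut1 fg)); congr Defs.cscale.
by apply: eq_bigr => l _; case: l.2; rewrite //= (aut_star fg).
Qed.

Lemma update_aut v x c : update (f \o v) x (f c) = f \o update v x c.
Proof. by apply/funext => y; rewrite /update /=; case: eqP. Qed.

(** An automorphism permutes each norm ball, so a quantifier sees the same values. *)
Lemma ball_values_aut v phi m x :
  (forall v, interp (f \o v) phi = interp v phi) ->
  [set interp (update (f \o v) x c) phi | c in [set c | cnorm c <= m]] =
  [set interp (update v x c) phi | c in [set c | cnorm c <= m]].
Proof.
move=> IH; apply/seteqP; split=> _ [c /= cm <-].
  exists (g c); first by rewrite /= -(aut_norm fg) (autKV fg).
  by rewrite -IH -update_aut (autKV fg).
exists (f c); first by rewrite /= (aut_norm fg).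
by rewrite update_aut IH.
Qed.

Lemma interp_aut v phi : interp (f \o v) phi = interp v phi.
Proof.
elim: phi v => [p|n h psi IH|m m0 x psi IH|m m0 x psi IH] v /=.
- by rewrite starpoly_eval_aut (aut_norm fg).
- by congr (conn_fun h _); apply/rowP => i; rewrite !mxE IH.
- by rewrite ball_values_aut.
- by rewrite ball_values_aut.
Qed.

End Interp.

Lemma interp_finite_support (phi : formula R nat) : exists N, forall v v' : nat -> C,
  (forall n, (n < N)%N -> v n = v' n) -> interp v phi = interp v' phi.
Proof.
have upd (v v' : nat -> C) N x c : (forall n, (n < N)%N -> v n = v' n) ->
    forall n, (n < N)%N -> update v x c n = update v' x c n.
  by move=> vv' n nN; rewrite /update vv'.
elim: phi => [p|n h psi IH|m m0 x psi [N IH]|m m0 x psi [N IH]] /=.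
- exists (\max_(m <- p) \max_(l <- m.2) l.1.+1)%N => v v' vv'; congr cnorm.
  rewrite /starpoly_eval !big_seq; apply: eq_bigr => m mp; congr Defs.cscale.
  rewrite !big_seq; apply: eq_bigr => l lm; rewrite vv' //.
  apply: leq_trans (leq_bigmax_seq _ mp isT).
  exact: (@leq_bigmax_seq _ _ _ (fun l : nat * bool => l.1.+1) l lm isT).
- have [N HN] := choice IH; exists (\max_i N i)%N => v v' vv'.
  congr (conn_fun h _); apply/rowP => i; rewrite !mxE; apply: HN => k ki.
  by apply: vv'; rewrite (leq_trans ki) // leq_bigmax.
- exists N => v v' vv'; congr sup; apply: eq_imagel => c _.
  exact/IH/upd.
- exists N => v v' vv'; congr inf; apply: eq_imagel => c _.
  exact/IH/upd.
Qed.

(** As a formula has finitely many free variables, it is enough that automorphisms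
    match arbitrarily long initial segments; the automorphism may depend on the
    length. *)
Lemma type_of_eq (a b : nat -> C) :
  (forall N, exists f g, automorphism f g /\
     forall n, (n < N)%N -> f (a n) = b n) ->
  type_of a = type_of b.
Proof.
move=> conj; apply/seteqP.
suff E k : satisfies a k = satisfies b k by split=> k; rewrite /type_of /= E.
rewrite /satisfies; have [N HN] := interp_finite_support (cond_formula k).
have [f [g [fg fab]]] := conj N.
by rewrite -(HN (f \o a) b fab) (interp_aut fg).
Qed.

End Automorphism.

(** * Matrix units and their commutants in the Calkin algebra *)
Definition affine (N i m : nat) : nat := (N * m + i)%N.

Lemma affine_inj N i : (0 < N)%N -> injective (affine N i).
Proof. by move=> N0 m n /addIn/eqP; rewrite eqn_pmul2l // => /eqP. Qed.

Section AffineIsometries.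
Variables (R : realType) (H : completeNormedModType R[i]).
Variable dot : {dot H for Num.conj}.
Hypothesis dot_norm : forall x : H, `|x| ^+ 2 = dot x x.
Variable e : nat -> H.
Hypothesis onb_e : onb dot e.
Implicit Types (T V : bop H) (t u : calkin dot).

Local Notation adj := (adjoint dot).
Local Notation pull := (pull dot e).
Local Notation push := (push dot e).
Local Notation cls := (cls dot).
Local Notation shift := (shift dot e).
Local Notation unshift := (unshift dot e).
Local Notation qshift := (qshift dot e).
Local Notation qunshift := (qunshift dot e).

Definition qpush N i : calkin dot := cls (push (affine N i)).
Definition qpull N i : calkin dot := cls (pull (affine N i)).

Lemma pull_push_affine N (i j : 'I_N) :
  pull (affine N i) * push (affine N j) = (i == j)%:R.
Proof.
have N0 : (0 < N)%N := leq_ltn_trans (leq0n i) (ltn_ord i).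
have [<-|ij] := eqVneq i j; first by rewrite pullK //; exact: affine_inj.
apply: (pull_push_disjoint dot_norm onb_e); try exact: affine_inj.
move=> m n mn; case/eqP: ij; apply: val_inj => /=.
have /(congr1 (modn^~ N)) := mn; rewrite /affine !(mulnC N) !modnMDl.
by rewrite !modn_small.
Qed.

Lemma sum_push_pull_affine N : (0 < N)%N ->
  \sum_(i < N) push (affine N i) * pull (affine N i) = 1.
Proof.
move=> N0; apply: bop_ext => x; apply: (onb_ext onb_e) => n.
have nN : (n %% N < N)%N by rewrite ltn_mod.
rewrite bopE_sum dot_suml (bigD1 (Ordinal nN)) //= big1 ?addr0 => [|i iN].
  rewrite (pushE dot_norm onb_e).
  have nE : affine N (n %% N) (n %/ N) = n by rewrite /affine mulnC -divn_eq.
  rewrite -[in e n]nE (pull_e dot_norm onb_e); last exact: affine_inj.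
  by rewrite (pullE dot_norm onb_e) ?nE //; exact: affine_inj.
rewrite (pushE dot_norm onb_e) (pull_e_out dot_norm onb_e) ?dot0r //.
  exact: affine_inj.
move=> m mn; case/eqP: iN; apply: val_inj => /=.
by rewrite -mn /affine mulnC modnMDl modn_small.
Qed.

Lemma qpull_qpush N (i j : 'I_N) : qpull N i * qpush N j = (i == j)%:R.
Proof. by rewrite -clsM pull_push_affine; case: (i == j); rewrite ?cls0. Qed.

Lemma qpullK N i : (0 < N)%N -> qpull N i * qpush N i = 1.
Proof. by move=> N0; rewrite -clsM pullK //; exact: affine_inj. Qed.

Lemma sum_qpush_qpull N : (0 < N)%N -> \sum_(i < N) qpush N i * qpull N i = 1.
Proof.
move=> N0; rewrite -cls1 -(sum_push_pull_affine N0) cls_sum.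
by apply: eq_bigr => i _; rewrite clsM.
Qed.

Lemma qshift_qpush N i : (0 < N)%N -> qshift ^+ N * qpush N i = qpush N i * qshift.
Proof.
move=> N0; rewrite -cls_shiftX -!clsM (shiftX dot_norm onb_e) /shift.
rewrite !(pushM dot_norm onb_e) //; try exact: addn_inj; try exact: affine_inj.
by congr (cls (push _)); apply/funext => m /=; rewrite /affine mulnDr muln1 addnA.
Qed.

Lemma qpull_qunshift N i : (0 < N)%N -> qpull N i * qunshift ^+ N = qunshift * qpull N i.
Proof.
move=> N0; rewrite -cls_unshiftX -!clsM (unshiftX dot_norm onb_e) /unshift.
rewrite !(pullM dot_norm onb_e) //; try exact: addn_inj; try exact: affine_inj.
by congr (cls (pull _)); apply/funext => m /=; rewrite /affine mulnDr muln1 addnA.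
Qed.

Lemma qshift_qpushX N i l : (0 < N)%N ->
  qshift ^+ (N * l) * qpush N i = qpush N i * qshift ^+ l.
Proof.
move=> N0; rewrite exprM; elim: l => [|l IH]; first by rewrite !expr0 mul1r mulr1.
by rewrite exprSr -mulrA qshift_qpush // mulrA IH -mulrA -exprSr.
Qed.

Lemma qpull_qunshiftX N i l : (0 < N)%N ->
  qpull N i * qunshift ^+ (N * l) = qunshift ^+ l * qpull N i.
Proof.
move=> N0; rewrite exprM; elim: l => [|l IH]; first by rewrite !expr0 mul1r mulr1.
by rewrite exprS mulrA qpull_qunshift // -mulrA IH mulrA -exprS.
Qed.

Local Notation campl N := (amp (fun i : 'I_N => qpush N i) (fun i : 'I_N => qpull N i)).

Lemma liftable_amp N t : (0 < N)%N -> liftable t -> liftable (campl N t).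
Proof.
move=> N0 [V [V' [VV' V'V ->]]].
pose bampl := amp (fun i : 'I_N => push (affine N i)) (fun i : 'I_N => pull (affine N i)).
have ba T S : bampl (T * S) = bampl T * bampl S.
  by apply: ampM => i j; exact: pull_push_affine.
have b1 : bampl 1 = 1 by apply: amp1; exact: sum_push_pull_affine.
exists (bampl V), (bampl V'); split; rewrite -?ba ?VV' ?V'V //.
by rewrite /bampl /amp cls_sum; apply: eq_bigr => i _; rewrite !clsM.
Qed.

Lemma amp_qshift N : (0 < N)%N -> campl N qshift = qshift ^+ N.
Proof.
move=> N0; apply: amp_intertwine => [|i]; first exact: sum_qpush_qpull.
exact: qshift_qpush.
Qed.

Lemma amp_qunshift N : (0 < N)%N -> campl N qunshift = qunshift ^+ N.
Proof.
move=> N0; apply: amp_intertwine_r => [|i]; first exact: sum_qpush_qpull.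
exact: qpull_qunshift.
Qed.

(** The index of an element commuting with a unital copy of the N x N matrices is
    divisible by N: the element is an amplification, and amplification turns the
    shift into its N-th power. *)
Lemma commutant_index N t t' : (0 < N)%N -> t * t' = 1 -> t' * t = 1 ->
  (forall i : 'I_N, t * (qpush N 0 * qpull N i) = (qpush N 0 * qpull N i) * t) ->
  exists a b, liftable (qshift ^+ (N * a) * qunshift ^+ (N * b) * t).
Proof.
move=> N0 tt' t't tE; pose i0 := Ordinal N0.
have e00 : t * (qpush N 0 * qpull N 0) = (qpush N 0 * qpull N 0) * t by exact: (tE i0).
have [||a [b lift]] := fredholm_liftable dot_norm onb_e (u := qpull N 0 * t * qpush N 0)
  (v := qpull N 0 * t' * qpush N 0).
- have -> : qpull N 0 * t * qpush N 0 * (qpull N 0 * t' * qpush N 0) =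
      qpull N 0 * (t * (qpush N 0 * qpull N 0)) * t' * qpush N 0 by rewrite !mulrA.
  by rewrite e00 !mulrA qpullK // mul1r -(mulrA (qpull N 0)) tt' mulr1 qpullK.
- have -> : qpull N 0 * t' * qpush N 0 * (qpull N 0 * t * qpush N 0) =
      qpull N 0 * t' * (qpush N 0 * qpull N 0 * t) * qpush N 0 by rewrite !mulrA.
  by rewrite -e00 !mulrA -(mulrA (qpull N 0)) t't mulr1 qpullK // mul1r qpullK.
exists a, b; have := liftable_amp N0 lift.
have sv' := sum_qpush_qpull N0; have vs' := @qpull_qpush N.
rewrite (ampM vs' _ (qpull N 0 * t * qpush N 0)) (ampM vs' (qshift ^+ a)).
rewrite !(ampX vs' sv') amp_qshift // amp_qunshift // -!exprM.
by have -> : campl N (qpull N 0 * t * qpush N 0) = t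
  by exact: (@amp_commutant _ _ _ _ vs' sv' i0 t tE).
Qed.

(** A product of forward and backward shifts lifts only when it is balanced, so the
    index of a class is unambiguous. *)
Lemma qshift_liftable a b c d :
  liftable (qshift ^+ a * qunshift ^+ b * (qshift ^+ d * qunshift ^+ c)) ->
  (a + d = b + c)%N.
Proof.
have ww := qshiftK dot_norm onb_e; have w_w := qunshiftK dot_norm onb_e.
have wC : GRing.comm qunshift qshift by rewrite /GRing.comm ww w_w.
have -> : qshift ^+ a * qunshift ^+ b * (qshift ^+ d * qunshift ^+ c) =
    qshift ^+ (a + d) * qunshift ^+ (b + c).
  rewrite -mulrA (mulrA (qunshift ^+ b)) (commrX d (commr_sym (commrX b (commr_sym wC)))).
  by rewrite !exprD !mulrA.
move: (a + d)%N (b + c)%N => {a b c d} p q lift.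
have [pq|qp|//] := ltngtP p q; exfalso.
  apply: (shift_not_liftable dot_norm onb_e (k := q - p)); first by rewrite subn_gt0.
  apply: (liftable_inv lift).
  by rewrite mulrA -exprD subnK ?(ltnW pq) // (qshiftKX dot_norm onb_e).
apply: (shift_not_liftable dot_norm onb_e (k := p - q)); first by rewrite subn_gt0.
move: lift; rewrite -{1}(subnK (ltnW qp)) exprD -mulrA (qshiftKX dot_norm onb_e).
by rewrite mulr1.
Qed.

End AffineIsometries.

(** * Two sequences with the same type *)
Section Witness.
Variables (R : realType) (H : completeNormedModType R[i]).
Variable dot : {dot H for Num.conj}.
Hypothesis dot_norm : forall x : H, `|x| ^+ 2 = dot x x.
Variable e : nat -> H.
Hypothesis onb_e : onb dot e.

Local Notation adj := (adjoint dot).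
Local Notation pull := (pull dot e).
Local Notation push := (push dot e).
Local Notation cls := (cls dot).
Local Notation qshift := (qshift dot e).
Local Notation qunshift := (qunshift dot e).
Local Notation qpush := (qpush dot e).
Local Notation qpull := (qpull dot e).

(** The truncations of the 2-adic integer -1/3, which is not an integer. *)
Fixpoint offset n : nat := if n is m.+1 then (offset m + 4 ^ m)%N else 0.

Lemma offsetE n : (3 * offset n + 1 = 4 ^ n)%N.
Proof. by elim: n => // n IH /=; rewrite expnS; lia. Qed.

Lemma offset_congr n m : (n <= m)%N -> exists l, offset m = (offset n + 4 ^ n * l)%N.
Proof.
move=> /subnKC <-; elim: (m - n)%N => [|k [l IH]].
  by exists 0%N; rewrite addn0 muln0 addn0.
exists (l + 4 ^ k)%N; rewrite addnS /= IH expnD; lia.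
Qed.

Definition row_unit n i : calkin dot := qpush (4 ^ n) 0 * qpull (4 ^ n) i.

Lemma row_unit00 : row_unit 0 0 = 1.
Proof.
rewrite /row_unit /qpush /qpull -clsM; have -> : affine (4 ^ 0) 0 = id.
  by apply/funext => m; rewrite /affine expn0 mul1n addn0.
by rewrite (push_id dot_norm onb_e) (pull_id dot_norm onb_e) mulr1.
Qed.

Definition corner (d : bool) (x : calkin dot) : calkin dot := qpush 2 d * x * qpull 2 d.

Definition elt_a (q : bool * (nat * nat)) : calkin dot :=
  corner q.1 (row_unit q.2.1 q.2.2).

Definition elt_b (q : bool * (nat * nat)) : calkin dot :=
  let: (d, (n, i)) := q in
  corner d (if d then qshift ^+ offset n * row_unit n i * qunshift ^+ offset n
            else row_unit n i).

(** The sequences are indexed by nat through the countability of bool * (nat * nat);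
    codes of no triple are sent to 0. *)
Definition from_index (x : bool * (nat * nat) -> calkin dot) (k : nat) : calkin dot :=
  if unpickle k is Some q then x q else 0.

(** Shifting the odd basis vectors by K places among themselves: the unitary of Q
    which is 1 on the even corner and w^K on the odd one. *)
Definition stretch K m : nat := if odd m then (m + 2 * K)%N else m.

Lemma stretch_inj K : injective (stretch K).
Proof.
by move=> m n; rewrite /stretch; case: ifP => om; case: ifP => on; lia.
Qed.

Definition qstretch K : calkin dot := cls (push (stretch K)).
Definition qunstretch K : calkin dot := cls (pull (stretch K)).

Lemma stretch_even K : stretch K \o affine 2 0 = affine 2 0.
Proof. by apply/funext => m; rewrite /stretch /affine /= addn0 mul2n odd_double. Qed.

Lemma stretch_odd K : stretch K \o affine 2 1 = affine 2 1 \o addn K.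
Proof.
apply/funext => m; rewrite /stretch /affine /= addn1 mul2n /= odd_double /=; lia.
Qed.

Lemma qstretch_even K : qstretch K * qpush 2 0 = qpush 2 0.
Proof.
rewrite /qstretch /qpush -clsM.
by rewrite (pushM dot_norm onb_e (@stretch_inj K) (@affine_inj 2 0 isT)) stretch_even.
Qed.

Lemma qstretch_odd K : qstretch K * qpush 2 1 = qpush 2 1 * qshift ^+ K.
Proof.
rewrite /qstretch /qpush -cls_shiftX -!clsM (shiftX dot_norm onb_e).
rewrite (pushM dot_norm onb_e (@stretch_inj K) (@affine_inj 2 1 isT)) stretch_odd.
by rewrite (pushM dot_norm onb_e (@affine_inj 2 1 isT) (@addn_inj K)).
Qed.

Lemma even_qunstretch K : qpull 2 0 * qunstretch K = qpull 2 0.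
Proof.
rewrite /qunstretch /qpull -clsM.
by rewrite (pullM dot_norm onb_e (@stretch_inj K) (@affine_inj 2 0 isT)) stretch_even.
Qed.

Lemma odd_qunstretch K : qpull 2 1 * qunstretch K = qunshift ^+ K * qpull 2 1.
Proof.
rewrite /qunstretch /qpull -cls_unshiftX -!clsM (unshiftX dot_norm onb_e).
rewrite (pullM dot_norm onb_e (@stretch_inj K) (@affine_inj 2 1 isT)) stretch_odd.
by rewrite (pullM dot_norm onb_e (@affine_inj 2 1 isT) (@addn_inj K)).
Qed.

Lemma qunstretchK K : qunstretch K * qstretch K = 1.
Proof. by rewrite -clsM pullK //; exact: stretch_inj. Qed.

(** The range of stretch K misses only K indices, so the isometry is unitary modulo
    compact operators; this follows from the corresponding fact for the shift. *)
Lemma qstretchK K : qstretch K * qunstretch K = 1.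
Proof.
have s2 := sum_qpush_qpull dot_norm onb_e (isT : (0 < 2)%N).
rewrite -[qstretch K]mulr1 -s2 mulr_sumr mulr_suml !big_ord_recl !big_ord0 !addr0.
rewrite /= !mulrA qstretch_even qstretch_odd -!mulrA even_qunstretch odd_qunstretch.
by rewrite (mulrA (qshift ^+ K)) (qshiftKX dot_norm onb_e) mul1r.
Qed.

Lemma qstretch_aut K : automorphism (fun p => qstretch K * p * qunstretch K)
  (fun p => qunstretch K * p * qstretch K).
Proof.
have uK : cancel (fun p => qstretch K * p * qunstretch K)
    (fun p => qunstretch K * p * qstretch K).
  by move=> p; rewrite !mulrA qunstretchK mul1r -mulrA qunstretchK mulr1.
have u'K : cancel (fun p => qunstretch K * p * qstretch K)
    (fun p => qstretch K * p * qunstretch K).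
  by move=> p; rewrite !mulrA qstretchK mul1r -mulrA qstretchK mulr1.
have contr (f g : bop H) p : (forall x, rnorm (f x) <= rnorm x) ->
    (forall x, rnorm (g x) <= rnorm x) -> cnorm (cls f * p * cls g) <= cnorm p.
  exact: cnorm_contract.
have ps := push_norm dot_norm onb_e (@stretch_inj K).
have pl := pull_norm dot_norm onb_e (@stretch_inj K).
split => //.
- by move=> p q; rewrite mulrDr mulrDl.
- by move=> p q; rewrite !mulrA -(mulrA _ (qunstretch K) (qstretch K)) qunstretchK mulr1.
- by rewrite mulr1 qstretchK.
- move=> a p; have [T ->] := clsP p; rewrite -[Defs.cscale a _]/(a *: _).
  rewrite -[Defs.cscale a _]/(a *: _) -clsZ -!clsM -clsZ; congr cls.
  apply: bop_ext => x.
  by rewrite -[LHS]/(push _ (a *: T (pull (stretch K) x))) bopZ.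
- move=> p; have [T ->] := clsP p.
  rewrite /= (cls_star dot_norm onb_e) /qstretch /qunstretch -!clsM.
  rewrite (cls_star dot_norm onb_e).
  by rewrite !(adjointM dot_norm onb_e) /push (adjointK dot_norm onb_e) mulrA.
- move=> p; apply/eqP; rewrite eq_le contr //=.
  by rewrite -[in leLHS](uK p) contr.
Qed.

(** All levels n <= m are treated by the same K = offset m: it differs from offset n
    by a multiple of 4^n, and w^(4^n l) commutes with level n. *)
Lemma qstretch_conj K n i d : (exists2 m, (n <= m)%N & K = offset m) ->
  qstretch K * elt_a (d, (n, i)) * qunstretch K = elt_b (d, (n, i)).
Proof.
move=> [m nm ->]; rewrite /elt_a /elt_b /corner /=; case: d; last first.
  by rewrite !mulrA qstretch_even -!mulrA even_qunstretch.
rewrite !mulrA qstretch_odd -!mulrA odd_qunstretch /row_unit.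
have [l ->] := offset_congr nm; have p0 : (0 < 4 ^ n)%N by rewrite expn_gt0.
rewrite exprD [in qunshift ^+ _]addnC exprD -!mulrA; congr (_ * (_ * _)).
rewrite [qshift ^+ (_ * l) * _]mulrA (qshift_qpushX dot_norm onb_e) //.
rewrite [qpull (4 ^ n) i * _]mulrA (qpull_qunshiftX dot_norm onb_e) //.
rewrite -!mulrA; congr (_ * _).
by rewrite mulrA (qshiftKX dot_norm onb_e) mul1r.
Qed.

Definition seq_a := from_index elt_a.
Definition seq_b := from_index elt_b.

Lemma same_type : type_of seq_a = type_of seq_b.
Proof.
apply: type_of_eq => N.
(* The highest level occurring among the first N entries. *)
pose lvl k := if @unpickle (bool * (nat * nat))%type k is Some q then q.2.1 else 0%N.
pose M := (\max_(k < N) lvl k)%N.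
exists (fun p => qstretch (offset M) * p * qunstretch (offset M)),
  (fun p => qunstretch (offset M) * p * qstretch (offset M)).
split=> [|k kN]; first exact: qstretch_aut.
rewrite /seq_a /seq_b /from_index; case kE : unpickle => [[d [n i]]|]; last first.
  by rewrite mulr0 mul0r.
apply: qstretch_conj; exists M => //.
have := leq_bigmax (F := fun k : 'I_N => lvl k) (Ordinal kN).
by rewrite /= {1}/lvl kE.
Qed.

(** Compressing d to an operator D from the even to the odd corner, the index of D is
    congruent to offset n modulo 4^n for every n. *)
Lemma no_intertwiner (d z : calkin dot) :
  z * d = elt_b (false, (0, 0)) -> d * z = elt_b (true, (0, 0)) ->
  (forall n i, d * elt_b (false, (n, i)) = elt_b (true, (n, i)) * d) -> False.
Proof.
have v0s0 : qpull 2 0 * qpush 2 0 = 1 by exact: qpullK.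
have v1s1 : qpull 2 1 * qpush 2 1 = 1 by exact: qpullK.
rewrite /elt_b /corner row_unit00 !expr0 !mulr1 => zd dz inter.
pose D := qpull 2 1 * d * qpush 2 0; pose D' := qpull 2 0 * z * qpush 2 1.
have DD' : D * D' = 1.
  have -> : D * D' = qpull 2 1 * d * (qpush 2 0 * qpull 2 0) * z * qpush 2 1.
    by rewrite !mulrA.
  rewrite -zd; have -> : qpull 2 1 * d * (z * d) * z * qpush 2 1 =
    qpull 2 1 * (d * z) * (d * z) * qpush 2 1 by rewrite !mulrA.
  by rewrite dz !mulrA !(v1s1, mul1r).
have D'D : D' * D = 1.
  have -> : D' * D = qpull 2 0 * z * (qpush 2 1 * qpull 2 1) * d * qpush 2 0.
    by rewrite !mulrA.
  rewrite -dz; have -> : qpull 2 0 * z * (d * z) * d * qpush 2 0 =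
    qpull 2 0 * (z * d) * (z * d) * qpush 2 0 by rewrite !mulrA.
  by rewrite zd !mulrA !(v0s0, mul1r).
have DE n i : D * row_unit n i =
    qshift ^+ offset n * row_unit n i * qunshift ^+ offset n * D.
  have := congr1 (fun x => qpull 2 1 * x * qpush 2 0) (inter n i).
  by rewrite !mulrA v1s1 mul1r -(mulrA _ (qpull 2 0) (qpush 2 0)) v0s0 mulr1 => ->.
clearbody D D'.
have idx n : exists p q,
    liftable (qshift ^+ (4 ^ n * p) * qunshift ^+ (4 ^ n * q + offset n) * D).
  have p0 : (0 < 4 ^ n)%N by rewrite expn_gt0.
  have [||i|p [q lift]] := @commutant_index _ _ _ dot_norm _ onb_e (4 ^ n)
    (qunshift ^+ offset n * D) (D' * qshift ^+ offset n) p0.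
  - by rewrite mulrA -(mulrA _ D) DD' mulr1 (qunshiftKX dot_norm onb_e).
  - by rewrite mulrA -(mulrA D') (qshiftKX dot_norm onb_e) mulr1 D'D.
  - rewrite -mulrA DE !mulrA (qunshiftKX dot_norm onb_e) mul1r.
    by rewrite /row_unit.
  by exists p, q; move: lift; rewrite exprD !mulrA.
have [c [c' lift0]] := idx 0; rewrite /= addn0 !mul1n in lift0.
(* The index of D is c' - c; 4 ^ n exceeds three times its absolute value. *)
pose n := (3 * (c + c') + 1)%N.
have [p [q lift]] := idx n.
have liftD : liftable (D' * (qshift ^+ c' * qunshift ^+ c)).
  apply: (liftable_inv lift0).
  rewrite -!mulrA (mulrA (qunshift ^+ c)) (qunshiftKX dot_norm onb_e) mul1r.
  by rewrite (mulrA (qshift ^+ c')) (qshiftKX dot_norm onb_e) mul1r D'D.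
have := liftableM lift liftD; rewrite mulrA -(mulrA _ D) DD' mulr1.
move=> /(qshift_liftable dot_norm onb_e).
have := offsetE n; have : (n < 4 ^ n)%N by apply: ltn_expl.
move: (offset n) (4 ^ n)%N => k N; rewrite /n => Nn kN E.
have [pq|qp] := leqP p q.
  have : (N * p <= N * q)%N by rewrite leq_mul2l pq orbT.
  lia.
have : (N * q.+1 <= N * p)%N by rewrite leq_mul2l qp orbT.
rewrite mulnS; lia.
Qed.

End Witness.

(** * The distinguishing quantifier-free type *)
Section DistinguishingType.
Variables (R : realType) (H : completeNormedModType R[i]).
Variable dot : {dot H for Num.conj}.
Hypothesis dot_norm : forall x : H, `|x| ^+ 2 = dot x x.
Variable e : nat -> H.
Hypothesis onb_e : onb dot e.

Local Notation seq_a := (seq_a dot e).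
Local Notation seq_b := (seq_b dot e).
Local Notation elt_a := (elt_a dot e).
Local Notation elt_b := (elt_b dot e).
Local Notation qpush := (qpush dot e).
Local Notation qpull := (qpull dot e).

Definition intertwiner (_ : 'I_1) : calkin dot := qpush 2 1 * qpull 2 0.

(** Taking all quantifier-free conditions that hold over the first sequence makes the
    type realized there by construction, and a part of the full type of the extended
    sequence. *)
Definition qf_type : set (condition R (nat + 'I_1)%type) :=
  [set k | quantifier_free (cond_formula k) /\ satisfies (extend seq_a intertwiner) k].

Definition xvar (q : bool * (nat * nat)) : (nat + 'I_1)%type := inl (pickle q).
Definition yvar : (nat + 'I_1)%type := inr ord0.

Lemma extend_seq_a q (d : 'I_1 -> calkin dot) : extend seq_a d (xvar q) = elt_a q.
Proof. by rewrite /extend /xvar /seq_a /from_index pickleK. Qed.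

Lemma extend_seq_b q (d : 'I_1 -> calkin dot) : extend seq_b d (xvar q) = elt_b q.
Proof. by rewrite /extend /xvar /seq_b /from_index pickleK. Qed.

Lemma qf_type_has_domains : has_domains qf_type.
Proof.
move=> x; pose r := cnorm (extend seq_a intertwiner x).
exists (Num.truncn r).+1 => //; split => //.
rewrite /satisfies /= /starpoly_eval big_seq1 /= big_seq1 /=.
rewrite -[Defs.cscale 1 _]/(1 *: _) scale1r.
exact/ltW/truncnS_gt.
Qed.

Definition word (x : (nat + 'I_1)%type -> calkin dot)
  (l : seq ((nat + 'I_1)%type * bool)) : calkin dot :=
  \prod_(i <- l) (if i.2 then star (x i.1) else x i.1).

Definition word_eq (l r : seq ((nat + 'I_1)%type * bool)) :
    condition R (nat + 'I_1)%type :=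
  Cond (Atom [:: (1, l); (-1, r)]) 0%:nng.

Lemma word_eqP x l r : satisfies x (word_eq l r) <-> word x l = word x r.
Proof.
rewrite /satisfies /= /starpoly_eval big_cons big_seq1 /=.
rewrite -[Defs.cscale 1 _]/(1 *: _) -[Defs.cscale (-1) _]/(-1 *: _).
rewrite scale1r scaleN1r -/(word x l) -/(word x r); split=> [|->].
  by move=> /(cnorm_eq0 dot_norm onb_e)/subr0_eq.
by rewrite subrr; exact: cnorm_zero.
Qed.

Lemma qf_type_omitted (d : 'I_1 -> calkin dot) : ~ realizes (extend seq_b d) qf_type.
Proof.
move=> real.
have transfer l r :
    word (extend seq_a intertwiner) l = word (extend seq_a intertwiner) r ->
    word (extend seq_b d) l = word (extend seq_b d) r.
  by move=> lr; apply/word_eqP; apply: real; split=> //; apply/word_eqP.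
have star_c : star (intertwiner ord0) = qpush 2 0 * qpull 2 1.
  rewrite /intertwiner /qpush /qpull -clsM (cls_star dot_norm onb_e).
  by rewrite (adjointM dot_norm onb_e) clsM /push (adjointK dot_norm onb_e).
have v0s0 : qpull 2 0 * qpush 2 0 = 1 by exact: qpullK.
have v1s1 : qpull 2 1 * qpush 2 1 = 1 by exact: qpullK.
have E00 := row_unit00 dot_norm onb_e.
pose y := [:: (yvar, false)]; pose y' := [:: (yvar, true)].
pose x q := [:: (xvar q, false)].
have wordM z l r : word z (l ++ r) = word z l * word z r by exact: big_cat.
have word_y z f : word (extend z f) y = f ord0 by rewrite /word big_seq1.
have word_y' z f : word (extend z f) y' = star (f ord0) by rewrite /word big_seq1.
have word_xa f q : word (extend seq_a f) (x q) = elt_a q.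
  by rewrite /word big_seq1 extend_seq_a.
have word_xb f q : word (extend seq_b f) (x q) = elt_b q.
  by rewrite /word big_seq1 extend_seq_b.
apply: (no_intertwiner dot_norm onb_e (d := d ord0) (z := star (d ord0))).
- rewrite -(word_y' seq_b d) -(word_y seq_b d) -wordM -(word_xb d); apply: transfer.
  rewrite wordM word_y word_y' word_xa star_c /intertwiner /elt_a /corner E00 mulr1.
  by rewrite mulrA -(mulrA (qpush 2 0)) v1s1 mulr1.
- rewrite -(word_y' seq_b d) -(word_y seq_b d) -wordM -(word_xb d); apply: transfer.
  rewrite wordM word_y word_y' word_xa star_c /intertwiner /elt_a /corner E00 mulr1.
  by rewrite mulrA -(mulrA (qpush 2 1)) v0s0 mulr1.
move=> n i; rewrite -(word_y seq_b d) -!(word_xb d) -!wordM; apply: transfer.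
rewrite !wordM word_y !word_xa /intertwiner /elt_a /corner /=.
rewrite !mulrA -(mulrA (qpush 2 1) (qpull 2 0) (qpush 2 0)) v0s0 mulr1.
by rewrite -(mulrA _ (qpull 2 1) (qpush 2 1)) v1s1 mulr1.
Qed.

End DistinguishingType.

Theorem theorem1 (R : realType) (H : completeNormedModType R[i])
  (dot : {dot H for Num.conj})
  (dot_norm : forall x : H, `|x| ^+ 2 = dot x x)
  (sepH : separable H) (infH : infinite_dimensional H) :
  ~ countably_homogeneous (calkin dot) /\
  exists a b : nat -> calkin dot,
    type_of a = type_of b /\
    exists k : nat, (1 <= k)%N /\
    exists t : set (condition R (nat + 'I_k)%type),
      [/\ has_domains t,
          forall c, t c -> quantifier_free (cond_formula c),
          exists c : 'I_k -> calkin dot, realizes (extend a c) t &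
          ~ exists d : 'I_k -> calkin dot, realizes (extend b d) t].
Proof.
have [e onb_e] := onb_exists dot_norm sepH infH.
have ab := same_type dot_norm onb_e.
split.
  move=> /(_ _ _ ab (qpush dot e 2 1 * qpull dot e 2 0))[d typ_d].
  apply: (@qf_type_omitted _ _ _ dot_norm _ onb_e (fun _ => d)) => k [_ kc].
  by have : type_of (extend (seq_a dot e) (intertwiner dot e)) k by []; rewrite typ_d.
exists (seq_a dot e), (seq_b dot e); split => //; exists 1%N; split => //.
exists (qf_type dot e); split.
- exact: qf_type_has_domains.
- by move=> k [].
- by exists (intertwiner dot e) => k [].
- by move=> [d]; exact: qf_type_omitted.
Qed.
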